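(* Fix a prime $p$ and $\theta\in\Omega_p$, let $\Gamma=\mathbb{Z}[\tfrac1p]\times\mathbb{Z}[\tfrac1p]$, and consider the spectral triple $(\mathcal{A}^{\mathcal S}_\theta,\ell^2(\Gamma),\mathcal{D}_p)$ with representation $\lambda_{\sigma_\theta}$ and smooth subalgebra $C_C(\Gamma,\sigma_\theta)$. Let $L_{\mathcal{D}_p}(a)=\|[\mathcal{D}_p,\lambda_{\sigma_\theta}(a)]\|_{\mathcal{B}(\ell^2(\Gamma))}$ for self-adjoint $a\in C_C(\Gamma,\sigma_\theta)$. Then $(\mathcal{A}^{\mathcal S}_\theta,L_{\mathcal{D}_p})$ is a Leibniz quantum compact metric space.
   Context: $\mathbb{Z}[\tfrac1p]=\{a/p^k\}$ as additive discrete group; $\mathbb{L}_p(r)=|r|+\|r\|_p$ with $\|\cdot\|_p$ the $p$-adic norm, and $\mathbb{L}_p^\Sigma(r_1,r_2)=\mathbb{L}_p(r_1)+\mathbb{L}_p(r_2)$. $\Omega_p$: sequences $(\theta_n)_{n\ge0}$ in $[0,1)$ with $p\theta_n\equiv\theta_{n-1}\bmod\mathbb{Z}$ for $n\ge1$. $\sigma_\theta((\tfrac{q_1}{p^{k_1}},\tfrac{q_2}{p^{k_2}}),(\tfrac{q_3}{p^{k_3}},\tfrac{q_4}{p^{k_4}}))=\exp(2\pi i\theta_{k_1+k_4}q_1q_4)$. $\mathcal{A}^{\mathcal S}_\theta=C^*(\Gamma,\sigma_\theta)$ is the twisted group $C^*$-algebra (enveloping $C^*$-algebra of $\ell^1(\Gamma,\sigma_\theta)$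 with twisted convolution $(f_1*_\sigma f_2)(\gamma)=\sum_{\gamma_1}f_1(\gamma_1)f_2(\gamma-\gamma_1)\sigma(\gamma_1,\gamma-\gamma_1)$), represented faithfully by the left-$\sigma_\theta$ regular representation $(\lambda_\sigma(f)g)(\gamma)=\sum_{\gamma_1}\sigma(\gamma_1,\gamma-\gamma_1)f(\gamma_1)g(\gamma-\gamma_1)$ on $\ell^2(\Gamma)$; $C_C(\Gamma,\sigma_\theta)$ = finitely supported functions; $\mathcal{D}_p$ = multiplication by $\mathbb{L}_p^\Sigma$ on $\ell^2(\Gamma)$. A Leibniz quantum compact metric space is a pair $(A,L)$ with $A$ a unital $C^*$-algebra and $L$ a seminorm on a dense subspace $\mathrm{dom}(L)$ of the self-adjoint part $sa(A)$ such that: (1) $\{a\in\mathrm{dom}(L):L(a)=0\}=\mathbb{R}1_A$; (2) the Monge–Kantorovich metric $mk_L(\varphi,\psi)=\sup\{|\varphi(a)-\psi(a)|:a\in\mathrm{dom}(L),L(a)\le1\}$ metrizes the weak$^*$ topology on the state space of $A$; (3) for $a,b\in\mathrm{dom}(L)$, $\frac{ab+ba}{2},\frac{ab-ba}{2i}\in\mathrm{dom}(L)$ and $\max\{L(\frac{ab+ba}{2}),L(\frac{ab-ba}{2i})\}\le L(a)\|b\|+\|a\|L(b)$; (4) $L$ is lower semicontinuous with respect to the norm topology on $\mathrm{dom}(L)$. *)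

(* Defs.v *)
From mathcomp Require Import all_boot all_order all_algebra.
From mathcomp Require Import all_classical all_reals all_analysis.
From mathcomp Require Import complex ring.
Set Implicit Arguments. Unset Strict Implicit. Unset Printing Implicit Defensive.
Import Order.TTheory GRing.Theory Num.Theory.
Local Open Scope ring_scope.
Local Open Scope classical_set_scope.

Definition Z1p_pred (p : nat) (r : rat) : bool :=
  `[< exists k : nat, exists z : int, r * (p%:Q) ^+ k = z%:~R >].

Definition Z1p (p : nat) := {r : rat | Z1p_pred p r}.

Lemma Z1p_addP p (r s : Z1p p) : Z1p_pred p (val r + val s).
Proof.
case: r => r hr; case: s => s hs /=.
case/asboolP: hr => k [z hz]; case/asboolP: hs => l [w hw].
apply/asboolP; exists (k + l)%N, (z * (p ^ l)%:Z + w * (p ^ k)%:Z).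
rewrite (_ : (r + s) * _ = (r * (p%:Q) ^+ k) * (p%:Q) ^+ l + (s * (p%:Q) ^+ l) * (p%:Q) ^+ k);
  last by rewrite exprD; ring.
by rewrite hz hw rmorphD !rmorphM /= -!pmulrn !natrX.
Qed.

Lemma Z1p_oppP p (r : Z1p p) : Z1p_pred p (- val r).
Proof.
case: r => r hr /=; case/asboolP: hr => k [z hz]; apply/asboolP; exists k, (- z).
by rewrite mulNr hz rmorphN.
Qed.

Definition z1p_add p (r s : Z1p p) : Z1p p := exist (fun x => Z1p_pred p x) _ (Z1p_addP r s).
Definition z1p_opp p (r : Z1p p) : Z1p p := exist (fun x => Z1p_pred p x) _ (Z1p_oppP r).

Definition Gam (p : nat) := (Z1p p * Z1p p)%type.
Definition gsub p (x y : Gam p) : Gam p :=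
  (z1p_add x.1 (z1p_opp y.1), z1p_add x.2 (z1p_opp y.2)).

Definition padic_norm (R : realType) (p : nat) (r : rat) : R :=
  if r == 0 then 0
  else (p%:R ^+ logn p `|denq r|%N) / (p%:R ^+ logn p `|numq r|%N).

Definition Lp (R : realType) p (r : Z1p p) : R :=
  `|ratr (val r)| + padic_norm R p (val r).

Definition LSig (R : realType) p (g : Gam p) : R := Lp R g.1 + Lp R g.2.

Definition Omega (R : realType) (p : nat) (theta : nat -> R) : Prop :=
  (forall n, 0 <= theta n < 1) /\
  (forall n, exists z : int, p%:R * theta n.+1 - theta n = z%:~R).

(* canonical writing r = q / p^k : k = v such that denq r = p^k, q = numq r *)
Definition kexp p (r : Z1p p) : nat := logn p `|denq (val r)|%N.
Definition qnum p (r : Z1p p) : int := numq (val r).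

Definition creal (R : realType) (t : R) : R[i] := (t%:C)%C.

Definition cexpi (R : realType) (t : R) : R[i] := (cos t +i* sin t)%C.

Definition sigma (R : realType) p (theta : nat -> R) (g1 g2 : Gam p) : R[i] :=
  cexpi (2 * pi * theta (kexp g1.1 + kexp g2.2)%N * (qnum g1.1 * qnum g2.2)%:~R).

Definition cabs (R : realType) (z : R[i]) : R :=
  Num.sqrt (complex.Re z ^+ 2 + complex.Im z ^+ 2).

Definition fin_supp (R : realType) p (g : Gam p -> R[i]) : Prop :=
  finite_set [set x | g x != 0].

Definition l2norm (R : realType) p (h : Gam p -> R[i]) : \bar R :=
  match (\esum_(x in [set: Gam p]) ((cabs (h x)) ^+ 2)%:E)%E with
  | r%:E => (Num.sqrt r)%:E
  | _ => +oo%E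
  end.

(* an operator on l^2(Gamma) is represented by its matrix K x y = <K d_y, d_x> *)
Definition mat (R : realType) p := Gam p -> Gam p -> R[i].

Definition mapp (R : realType) p (K : mat R p) (g : Gam p -> R[i]) : Gam p -> R[i] :=
  fun x => \sum_(y \in [set: Gam p]) K x y * g y.

(* operator norm: sup of ||K g|| over finitely supported unit vectors g
   (finitely supported vectors are dense in l^2) *)
Definition opnorm (R : realType) p (K : mat R p) : \bar R :=
  ereal_sup [set l2norm (mapp K g) | g in [set g | fin_supp g /\ (l2norm g <= 1)%E]].

Definition msub (R : realType) p (K1 K2 : mat R p) : mat R p := fun x y => K1 x y - K2 x y.
Definition idm (R : realType) p : mat R p := fun x y => (x == y)%:R.
Arguments idm {R p}.

Definition selfadj_mat (R : realType) p (K : mat R p) : Prop :=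
  forall x y, K x y = conjc (K y x).

Definition pos_op (R : realType) p (K : mat R p) : Prop :=
  forall g, fin_supp g -> 0 <= \sum_(x \in [set: Gam p]) mapp K g x * conjc (g x).

Definition CC (R : realType) p (f : Gam p -> R[i]) : Prop := fin_supp f.

Definition tconv (R : realType) p theta (f1 f2 : Gam p -> R[i]) : Gam p -> R[i] :=
  fun g => \sum_(g1 \in [set: Gam p]) f1 g1 * f2 (gsub g g1) * sigma theta g1 (gsub g g1).

(* matrix of lambda_sigma(f):
   (lambda(f) h)(x) = sum_{g1} sigma(g1, x - g1) f(g1) h(x - g1)
                    = sum_y sigma(x - y, y) f(x - y) h(y) *)
Definition lam (R : realType) p theta (f : Gam p -> R[i]) : mat R p :=
  fun x y => sigma theta (gsub x y) y * f (gsub x y).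

Definition Dp (R : realType) p (h : Gam p -> R[i]) : Gam p -> R[i] :=
  fun x => creal (LSig R x) * h x.

(* L_{D_p}(a) = || [D_p, lambda(a)] || (norm computed on the core of finitely
   supported vectors, which lambda(a) preserves) *)
Definition LD (R : realType) p theta (a : Gam p -> R[i]) : \bar R :=
  ereal_sup [set l2norm (fun x => Dp (mapp (lam theta a) g) x - mapp (lam theta a) (Dp g) x)
            | g in [set g | fin_supp g /\ (l2norm g <= 1)%E]].

(* the C*-algebra A^S_theta, identified with the norm closure of
   lambda(C_C(Gamma, sigma)) in B(l^2(Gamma)) *)
Definition inA (R : realType) p theta (K : mat R p) : Prop :=
  forall e : R, 0 < e -> exists f, CC f /\ (opnorm (msub K (lam theta f)) < e%:E)%E.

Definition domL (R : realType) p theta (a : Gam p -> R[i]) : Prop :=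
  CC a /\ selfadj_mat (lam theta a).

(* states of A: positive unital linear functionals
   (only their values on A matter) *)
Definition is_state (R : realType) p theta (phi : mat R p -> R[i]) : Prop :=
  [/\ (forall K1 K2 (c : R[i]), inA theta K1 -> inA theta K2 ->
         phi (fun x y => K1 x y + c * K2 x y) = phi K1 + c * phi K2),
      (forall K, inA theta K -> pos_op K -> 0 <= phi K) &
      phi (@idm R p) = 1%R].

Definition mkL (R : realType) p theta (phi psi : mat R p -> R[i]) : \bar R :=
  ereal_sup [set (cabs (phi (lam theta a) - psi (lam theta a)))%:E
            | a in [set a | domL theta a /\ (LD theta a <= 1)%E]].

Definition jordan (R : realType) p theta (a b : Gam p -> R[i]) : Gam p -> R[i] :=
  fun x => (tconv theta a b x + tconv theta b a x) / 2%:R.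
Definition lie (R : realType) p theta (a b : Gam p -> R[i]) : Gam p -> R[i] :=
  fun x => (tconv theta a b x - tconv theta b a x) / (2%:R * 'i%C).

Definition LeibnizQCMS (R : realType) p (theta : nat -> R) : Prop :=
  [/\
   [/\ (forall a : Gam p -> R[i], domL theta a -> inA theta (lam theta a)),
       (forall (a b : Gam p -> R[i]) (t : R), domL theta a -> domL theta b ->
          domL theta (fun x : Gam p => (a x + creal t * b x)%R)),
       (forall K : mat R p, inA theta K -> selfadj_mat K -> forall e : R, 0 < e ->
          exists a : Gam p -> R[i], domL theta a /\ (opnorm (msub K (lam theta a)) < e%:E)%E),
       (forall a : Gam p -> R[i], domL theta a -> (LD theta a < +oo)%E) &
       (forall (a b : Gam p -> R[i]) (t : R), domL theta a -> domL theta b ->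
          (LD theta (fun x : Gam p => (a x + b x)%R) <= LD theta a + LD theta b)%E /\
          LD theta (fun x : Gam p => (creal t * a x)%R) = (`|t|%:E * LD theta a)%E)],
   (forall a : Gam p -> R[i], domL theta a ->
      (LD theta a = 0%E <-> exists t : R, lam theta a = (fun x y : Gam p => (creal t * idm x y)%R))),
  (* (2) mk_L is a metric on S(A) metrizing the weak* topology *)
   [/\ (forall phi psi : mat R p -> R[i], is_state theta phi -> is_state theta psi ->
          (mkL theta phi psi < +oo)%E),
       (forall phi psi : mat R p -> R[i], is_state theta phi -> is_state theta psi ->
          mkL theta phi psi = 0%E -> forall K : mat R p, inA theta K -> phi K = psi K),
       (forall phi : mat R p -> R[i], is_state theta phi ->
          forall (s : seq (mat R p)) (e : R), (forall K : mat R p, K \in s -> inA theta K) -> 0 < e ->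
          exists2 d : R, 0 < d & forall psi : mat R p -> R[i], is_state theta psi ->
            (mkL theta phi psi < d%:E)%E ->
            forall K : mat R p, K \in s -> cabs (psi K - phi K) < e) &
       (forall phi : mat R p -> R[i], is_state theta phi -> forall d : R, 0 < d ->
          exists s : seq (mat R p), exists2 e : R,
            (forall K : mat R p, K \in s -> inA theta K) /\ 0 < e &
            forall psi : mat R p -> R[i], is_state theta psi ->
              (forall K : mat R p, K \in s -> cabs (psi K - phi K) < e) ->
              (mkL theta phi psi < d%:E)%E)],
   (forall (a b : Gam p -> R[i]), domL theta a -> domL theta b ->
      [/\ domL theta (jordan theta a b), domL theta (lie theta a b),
          (LD theta (jordan theta a b) <=
             LD theta a * opnorm (lam theta b) + opnorm (lam theta a) * LD theta b)%E &
          (LD theta (lie theta a b) <=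
             LD theta a * opnorm (lam theta b) + opnorm (lam theta a) * LD theta b)%E]) &
   (forall a : Gam p -> R[i], domL theta a -> forall e : R, 0 < e ->
      exists2 d : R, 0 < d & forall b : Gam p -> R[i], domL theta b ->
        (opnorm (msub (lam theta a) (lam theta b)) < d%:E)%E ->
        (LD theta a - e%:E < LD theta b)%E)].

(* Main.v *)
(* The point is that the elements [a] with [LD a <= 1] are, modulo scalars, totally
   bounded in norm. Let [F_n] be the box of pairs of fractions [q / p^n] of absolute value
   at most [p^n]; the boxes exhaust the group, are comparable to balls of radius [p^n]
   for the length [LSig], and satisfy [|F_(n+j)| <= p^(4j) |F_n|].
   If [y] lies in a translate of [F_n] and [x] outside the same translate of [F_(n+3)],
   then dividing the commutator matrix by the difference of lengths (the cocycle is a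
   bicharacter, so translating a block of [lam a] only conjugates it by unimodular
   diagonals) shows that the corresponding block of [lam a] has norm [O(p^-n)].
   Averaging such blocks over all translates is a Schur multiplier estimate in which
   the overlap is controlled by the ratio of the box sizes. It bounds the difference of two
   consecutive smooth truncations of [a], and a geometric series gives
   [||lam a - lam (cutoff n * a)|| = O(p^-n)], where [cutoff n * a] lives on
   [F_(n+4)] and has coefficients at most [1 / LSig]. Hence two states that are close on
   the finitely many unitaries [lam (delta x)], [x \in F_(n+4)], are close for [mkL]. *)

Require Import Defs.
From HB Require Import structures.
From mathcomp Require Import all_boot all_order all_algebra.
From mathcomp Require Import all_classical all_reals all_analysis.
From mathcomp Require Import complex ring lra zify.
Set Implicit Arguments. Unset Strict Implicit. Unset Printing Implicit Defensive.
Import Order.TTheory GRing.Theory Num.Theory.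
Local Open Scope ring_scope.
Local Open Scope classical_set_scope.

(** * The additive group Z[1/p] and its square *)

HB.instance Definition _ (p : nat) := Choice.on (Z1p p).

Lemma z1p_zero_subproof p : Z1p_pred p 0.
Proof. by apply/asboolP; exists 0%N, 0; rewrite mul0r. Qed.

Definition z1p_zero p : Z1p p := exist (fun x => Z1p_pred p x) 0 (z1p_zero_subproof p).

Lemma z1p_addA p : associative (@z1p_add p).
Proof. by move=> x y z; apply/val_inj; rewrite /= addrA. Qed.

Lemma z1p_addC p : commutative (@z1p_add p).
Proof. by move=> x y; apply/val_inj; rewrite /= addrC. Qed.

Lemma z1p_add0 p : left_id (z1p_zero p) (@z1p_add p).
Proof. by move=> x; apply/val_inj; rewrite /= add0r. Qed.

Lemma z1p_addN p : left_inverse (z1p_zero p) (@z1p_opp p) (@z1p_add p).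
Proof. by move=> x; apply/val_inj; rewrite /= addNr. Qed.

HB.instance Definition _ (p : nat) := GRing.isZmodule.Build (Z1p p)
  (@z1p_addA p) (@z1p_addC p) (@z1p_add0 p) (@z1p_addN p).
HB.instance Definition _ (p : nat) := GRing.Zmodule.on (Gam p).

(** Holds by conversion, since pairs carry the product group structure; it gives access to the
    general theory of abelian groups. *)
Lemma gsubE p (x y : Gam p) : gsub x y = x - y.
Proof. by []. Qed.

(** * The real-valued modulus of complex numbers *)

Section ComplexModulus.
Variable R : realType.
Implicit Types z w : R[i].

Lemma cabsC z : ((cabs z)%:C)%C = `|z|.
Proof. by rewrite normc_def. Qed.

Lemma cabs_ge0 z : 0 <= cabs z.
Proof. exact: sqrtr_ge0. Qed.

Lemma cabs0 : cabs 0 = 0 :> R.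
Proof. by apply: (@complexI R); rewrite cabsC normr0. Qed.

Lemma cabs1 : cabs 1 = 1 :> R.
Proof. by apply: (@complexI R); rewrite cabsC normr1. Qed.

Lemma cabsM z w : cabs (z * w) = cabs z * cabs w.
Proof. by apply: (@complexI R); rewrite rmorphM /= !cabsC normrM. Qed.

Lemma cabsN z : cabs (- z) = cabs z.
Proof. by apply: (@complexI R); rewrite !cabsC normrN. Qed.

Lemma cabsD z w : cabs (z + w) <= cabs z + cabs w.
Proof. by rewrite -lecR rmorphD /= !cabsC ler_normD. Qed.

Lemma cabsB z w : cabs (z - w) <= cabs z + cabs w.
Proof. by rewrite -(cabsN w) cabsD. Qed.

Lemma cabs_conj z : cabs (conjc z) = cabs z.
Proof. by case: z => a b; rewrite /cabs /= sqrrN. Qed.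

Lemma cabs_sum (I : Type) (s : seq I) (F : I -> R[i]) :
  cabs (\sum_(i <- s) F i) <= \sum_(i <- s) cabs (F i).
Proof.
elim: s => [|i s ih]; first by rewrite !big_nil cabs0.
by rewrite !big_cons (le_trans (cabsD _ _)) // lerD2l.
Qed.

Lemma cabs_creal (t : R) : cabs (creal t) = `|t|.
Proof. by rewrite /cabs /creal /= expr0n addr0 sqrtr_sqr. Qed.

Lemma cabs_eq0 z : (cabs z == 0) = (z == 0).
Proof. by rewrite -(inj_eq (@complexI R)) cabsC normr_eq0. Qed.

Lemma cabs_cexpi (t : R) : cabs (cexpi t) = 1.
Proof. by rewrite /cabs /= cos2Dsin2 sqrtr1. Qed.

Lemma mulcc z : z * conjc z = creal (cabs z ^+ 2).
Proof.
case: z => a b; rewrite /cabs sqr_sqrtr ?addr_ge0 ?sqr_ge0 //.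
by apply/eqP; rewrite eq_complex /=; apply/andP; split; apply/eqP; ring.
Qed.

Lemma crealD (s t : R) : creal (s + t) = creal s + creal t.
Proof. exact: rmorphD. Qed.

Lemma crealM (s t : R) : creal (s * t) = creal s * creal t.
Proof. exact: rmorphM. Qed.

Lemma crealN (t : R) : creal (- t) = - creal t.
Proof. exact: rmorphN. Qed.

Lemma crealB (s t : R) : creal (s - t) = creal s - creal t.
Proof. exact: rmorphB. Qed.

Lemma creal0 : creal 0 = 0 :> R[i]. Proof. by []. Qed.

Lemma creal1 : creal 1 = 1 :> R[i]. Proof. by []. Qed.

Lemma crealV (t : R) : creal t^-1 = (creal t)^-1.
Proof. exact: fmorphV. Qed.

Lemma creal_sum (I : Type) (s : seq I) (F : I -> R) :
  creal (\sum_(i <- s) F i) = \sum_(i <- s) creal (F i).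
Proof. exact: rmorph_sum. Qed.

Lemma conjcM z w : conjc (z * w) = conjc z * conjc w.
Proof. exact: rmorphM. Qed.

Lemma conjcD z w : conjc (z + w) = conjc z + conjc w.
Proof. exact: rmorphD. Qed.

Lemma conjcB z w : conjc (z - w) = conjc z - conjc w.
Proof. exact: rmorphB. Qed.

Lemma conjc_sum (I : Type) (s : seq I) (F : I -> R[i]) :
  conjc (\sum_(i <- s) F i) = \sum_(i <- s) conjc (F i).
Proof. exact: rmorph_sum. Qed.

Lemma conjc_creal (t : R) : conjc (creal t) = creal t.
Proof. by rewrite /conjc /creal /= oppr0. Qed.

End ComplexModulus.

(** * Norm bounds for infinite matrices *)

Section Forms.
Variables (R : realType) (p : nat).
Implicit Types (K : mat R p) (u v h : Gam p -> R[i]) (s : seq (Gam p)) (c : R).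

Definition form s u K v : R[i] := \sum_(x <- s) \sum_(y <- s) u x * K x y * v y.

Definition sqsum s h : R := \sum_(x <- s) cabs (h x) ^+ 2.

(* The norm bound [||K|| <= c], tested on finite blocks; the arithmetic mean of
   [|u|^2] and [|v|^2] replaces the product [|u||v|], which is equivalent by
   scaling and needs no Cauchy-Schwarz inequality. *)
Definition Bnd K c : Prop :=
  forall s u v, uniq s -> cabs (form s u K v) <= c * ((sqsum s u + sqsum s v) / 2).

(** Sums over the whole group are finitary sums, with default 0 on infinite support; a
    duplicate-free list containing the support turns them into list sums. *)
Lemma fsumE (F : Gam p -> R[i]) s : uniq s -> (forall x, x \notin s -> F x = 0) ->
  \sum_(x \in [set: Gam p]) F x = \sum_(x <- s) F x.
Proof.
move=> us F0; rewrite (fsbigE s) //; last by move=> i _; apply: F0.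
by apply: eq_bigl => i; rewrite in_setT.
Qed.

Lemma sqsum_ge0 s h : 0 <= sqsum s h.
Proof. by apply: sumr_ge0 => x _; rewrite exprn_ge0 // cabs_ge0. Qed.

Lemma eq_sqsum s h h' : {in s, h =1 h'} -> sqsum s h = sqsum s h'.
Proof. by move=> e; apply: eq_big_seq => x xs; rewrite e. Qed.

Lemma sqsumZ s h (z : R[i]) : sqsum s (fun x => z * h x) = cabs z ^+ 2 * sqsum s h.
Proof. by rewrite mulr_sumr; apply: eq_bigr => x _; rewrite cabsM exprMn. Qed.

Lemma sqsum_le s h h' : (forall x, cabs (h x) <= cabs (h' x)) -> sqsum s h <= sqsum s h'.
Proof. by move=> le; apply: ler_sum => x _; rewrite lerXn2r ?nnegrE ?cabs_ge0. Qed.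

Lemma ler_sum_supp (F : Gam p -> R) s t : uniq s -> uniq t ->
  (forall x, 0 <= F x) -> (forall x, x \notin s -> F x = 0) ->
  \sum_(x <- t) F x <= \sum_(x <- s) F x.
Proof.
move=> us ut F0 Fs; rewrite (bigID (mem s)) /= [X in _ + X]big1 ?addr0 //.
rewrite -big_filter [X in _ <= X](bigID (mem t)) /= -[X in _ <= X + _]big_filter.
rewrite (perm_big [seq x <- s | x \in t]) /=; first by rewrite lerDl sumr_ge0.
by apply: uniq_perm; rewrite ?filter_uniq // => x; rewrite !mem_filter andbC.
Qed.

Lemma sqsum_supp s t h : uniq s -> uniq t -> (forall x, x \notin s -> h x = 0) ->
  sqsum t h <= sqsum s h.
Proof.
move=> us ut h0; apply: ler_sum_supp => // x; first by rewrite exprn_ge0 // cabs_ge0.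
by move=> /h0 ->; rewrite cabs0 expr0n.
Qed.

Lemma finsuppP h : fin_supp h ->
  exists2 s, uniq s & forall x, x \notin s -> h x = 0.
Proof.
move=> fh; exists (finmap.enum_fset (fset_set [set x | h x != 0])); first exact: finmap.fset_uniq.
move=> x; rewrite in_fset_set // => /negP nx.
by apply/eqP; apply: contra_notT nx => hx; rewrite inE.
Qed.

Lemma finsupp_seq s h : (forall x, x \notin s -> h x = 0) -> fin_supp h.
Proof.
move=> h0; apply: (@sub_finite_set _ _ [set` s]); last exact: finite_seq.
by move=> x /= ; apply: contra_neqT => /h0.
Qed.

Lemma l2norm_ge0 h : (0 <= l2norm h)%E.
Proof. by rewrite /l2norm; case: esum => // r; rewrite lee_fin sqrtr_ge0. Qed.

(** The unordered sum is the supremum of its finite partial sums, so a real bound on the extended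
    norm can be read off finite lists. *)
Lemma l2norm_leP h c : 0 <= c ->
  (l2norm h <= c%:E)%E <-> (forall s, uniq s -> sqsum s h <= c ^+ 2).
Proof.
move=> c0; rewrite /l2norm; set S := esum _ _.
have S0 : (0 <= S)%E.
  by apply: esum_ge0 => x _; rewrite lee_fin exprn_ge0 // cabs_ge0.
split.
  move=> le s us; have : ((sqsum s h)%:E <= S)%E.
    apply: esum_ge; exists [set` s]; first by split=> //; exact: finite_seq.
    by rewrite -fsbig_seq // -sumEFin.
  case: (S) S0 le => [r| |] //=; rewrite !lee_fin => r0 le.
  move=> /le_trans; apply.
  by rewrite -(sqr_sqrtr r0) lerXn2r ?nnegrE ?sqrtr_ge0.
move=> le; have : (S <= (c ^+ 2)%:E)%E.
  apply: ge_ereal_sup => _ [X [fX _] <-].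
  by rewrite fsbig_finite // sumEFin lee_fin le // finmap.fset_uniq.
case: (S) S0 => [r| |] //; rewrite !lee_fin => r0 le'.
by rewrite -(ger0_norm c0) -sqrtr_sqr ler_wsqrtr.
Qed.

End Forms.

(** * Calculus of norm bounds, and the Schur test *)

Section Bounds.
Variables (R : realType) (p : nat).
Implicit Types (K : mat R p) (u v g h : Gam p -> R[i]) (s : seq (Gam p)) (c : R).

Lemma mappE K g s x : uniq s -> (forall x, x \notin s -> g x = 0) ->
  mapp K g x = \sum_(y <- s) K x y * g y.
Proof.
by move=> us g0; rewrite /mapp (fsumE us) // => y /g0 ->; rewrite mulr0.
Qed.

Lemma eq_form s u v K u' v' K' : {in s, u =1 u'} -> {in s, v =1 v'} ->
  (forall x y, x \in s -> y \in s -> K x y = K' x y) -> form s u K v = form s u' K' v'.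
Proof.
move=> eu ev eK; apply: eq_big_seq => x xs; apply: eq_big_seq => y ys.
by rewrite eu // ev // eK.
Qed.

Lemma formD s u v K1 K2 :
  form s u (fun x y => K1 x y + K2 x y) v = form s u K1 v + form s u K2 v.
Proof.
rewrite /form -big_split; apply: eq_bigr => x _ /=.
by rewrite -big_split; apply: eq_bigr => y _ /=; ring.
Qed.

Lemma formZ s u v K (z : R[i]) :
  form s u (fun x y => z * K x y) v = z * form s u K v.
Proof.
rewrite /form mulr_sumr; apply: eq_bigr => x _ /=.
by rewrite mulr_sumr; apply: eq_bigr => y _ /=; ring.
Qed.

Lemma form_diag s u v K (d1 d2 : Gam p -> R[i]) :
  form s u (fun x y => d1 x * K x y * d2 y) v =
  form s (fun x => d1 x * u x) K (fun y => d2 y * v y).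
Proof. by apply: eq_bigr => x _; apply: eq_bigr => y _ /=; ring. Qed.

Lemma form_delta s u K v : uniq s ->
  form s u K v = \sum_(x <- s) u x * mapp K (fun y => if y \in s then v y else 0) x.
Proof.
move=> us; apply: eq_bigr => x _; rewrite (mappE _ _ us); last first.
  by move=> y /negbTE ->.
by rewrite mulr_sumr; apply: eq_big_seq => y ys; rewrite ys mulrA.
Qed.

Lemma Bnd_ge0 K c : Bnd K c -> 0 <= c.
Proof.
move=> /(_ [:: 0] (fun=> 1) (fun=> 1) isT); rewrite /sqsum !big_seq1 cabs1.
by move=> /(le_trans (cabs_ge0 _)); lra.
Qed.

Lemma Bnd_le K c c' : c <= c' -> Bnd K c -> Bnd K c'.
Proof.
move=> le B s u v us; apply: le_trans (B s u v us) _.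
by rewrite ler_wpM2r // divr_ge0 // addr_ge0 // sqsum_ge0.
Qed.

Lemma Bnd_lim K c : (forall e, 0 < e -> Bnd K (c + e)) -> Bnd K c.
Proof.
move=> B s u v us; set q := _ / 2.
have q0 : 0 <= q by rewrite divr_ge0 // addr_ge0 // sqsum_ge0.
apply/ler_addgt0Pr => e e0.
(* The weight [q] may vanish, hence division by [q + 1]. *)
have q1 : 0 < q + 1 by lra.
apply: le_trans (B (e / (q + 1)) (divr_gt0 e0 q1) s u v us) _.
rewrite -/q mulrDl lerD2l mulrAC ler_pdivrMr // ler_wpM2l //; lra.
Qed.

Lemma eq_Bnd K K' c : (forall x y, K x y = K' x y) -> Bnd K c -> Bnd K' c.
Proof. by move=> e B s u v us; rewrite -(@eq_form s u v K u v K') //; exact: B. Qed.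

Lemma BndD K1 K2 c1 c2 : Bnd K1 c1 -> Bnd K2 c2 ->
  Bnd (fun x y => K1 x y + K2 x y) (c1 + c2).
Proof.
move=> B1 B2 s u v us; rewrite formD (le_trans (cabsD _ _)) // mulrDl.
by rewrite lerD ?B1 ?B2.
Qed.

Lemma BndZ K (z : R[i]) c : Bnd K c -> Bnd (fun x y => z * K x y) (cabs z * c).
Proof.
by move=> B s u v us; rewrite formZ cabsM -mulrA ler_wpM2l ?cabs_ge0 ?B.
Qed.

Lemma BndN K c : Bnd K c -> Bnd (fun x y => - K x y) c.
Proof.
move=> /(BndZ (-1)); rewrite cabsN cabs1 mul1r.
by apply: eq_Bnd => x y; rewrite mulN1r.
Qed.

Lemma BndB K1 K2 c1 c2 : Bnd K1 c1 -> Bnd K2 c2 ->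
  Bnd (fun x y => K1 x y - K2 x y) (c1 + c2).
Proof. by move=> B1 B2; apply: BndD B1 (BndN B2). Qed.

Lemma Bnd0 : Bnd (fun _ _ => 0 : R[i]) 0 (p := p).
Proof.
move=> s u v _; rewrite mul0r /form big1 ?cabs0 // => x _.
by rewrite big1 // => y _; rewrite mulr0 mul0r.
Qed.

Lemma Bnd_diag K c (d1 d2 : Gam p -> R[i]) :
  (forall x, cabs (d1 x) <= 1) -> (forall x, cabs (d2 x) <= 1) ->
  Bnd K c -> Bnd (fun x y => d1 x * K x y * d2 y) c.
Proof.
move=> le1 le2 B s u v us; rewrite form_diag; apply: le_trans (B _ _ _ us) _.
rewrite ler_wpM2l ?(Bnd_ge0 B) // ler_wpM2r // lerD //; apply: sqsum_le => x;
  by rewrite cabsM ler_piMl // cabs_ge0.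
Qed.

(** Tested on the point masses at [x] and [y], for which the mean of the square norms is 1. *)
Lemma Bnd_entry K c x y : Bnd K c -> cabs (K x y) <= c.
Proof.
set d := fun a b : Gam p => (b == a)%:R : R[i].
have [s us [xs ys]] : exists2 s, uniq s & x \in s /\ y \in s.
  by exists (undup [:: x; y]); rewrite ?undup_uniq // !mem_undup !inE !eqxx orbT.
have S1 a : a \in s -> sqsum s (d a) = 1.
  move=> as_; rewrite /sqsum (bigD1_seq a) //= /d eqxx cabs1 expr1n big1 ?addr0 //.
  by move=> b /negbTE ->; rewrite cabs0 expr0n.
move=> /(_ _ (d x) (d y) us); rewrite !S1 //.
rewrite /form (bigD1_seq x) //= [X in _ + X]big1 ?addr0; last first.
  by move=> a /negbTE ax; rewrite big1 // => b _; rewrite /d ax !mul0r.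
rewrite (bigD1_seq y) //= [X in _ + X]big1 ?addr0; last first.
  by move=> b /negbTE yb; rewrite /d yb mulr0.
by rewrite /d !eqxx mul1r mulr1; lra.
Qed.

Lemma form_tr s u K v : form s u K v = form s v (fun x y => K y x) u.
Proof.
rewrite /form exchange_big; apply: eq_bigr => y _; apply: eq_bigr => x _ /=.
by ring.
Qed.

Lemma form_conj s u K v :
  conjc (form s u K v) = form s (conjc \o u) (fun x y => conjc (K x y)) (conjc \o v).
Proof.
rewrite /form rmorph_sum; apply: eq_bigr => x _.
by rewrite rmorph_sum; apply: eq_bigr => y _; rewrite /= !rmorphM.
Qed.

Lemma sqsum_conj s h : sqsum s (conjc \o h) = sqsum s h.
Proof. by apply: eq_bigr => x _; rewrite /= cabs_conj. Qed.

(** Transposition exchanges [u] and [v], which enter the bound symmetrically, and conjugation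
    preserves moduli. *)
Lemma Bnd_adj K c : Bnd K c -> Bnd (fun x y => conjc (K y x)) c.
Proof.
move=> B s u v us; rewrite form_tr -cabs_conj form_conj.
rewrite (@eq_form _ _ _ _ (conjc \o v) (conjc \o u) K) //; last first.
  by move=> x y _ _; rewrite conjcK.
apply: le_trans (B _ _ _ us) _; rewrite addrC !sqsum_conj //.
Qed.

Lemma Bnd_translate K c (g : Gam p) : Bnd K c -> Bnd (fun x y => K (x - g) (y - g)) c.
Proof.
move=> B s u v us.
have us' : uniq [seq x - g | x <- s] by rewrite map_inj_uniq //; exact: addIr.
have := B _ (fun x => u (x + g)) (fun x => v (x + g)) us'.
have tr h : sqsum [seq x - g | x <- s] (fun x => h (x + g)) = sqsum s h.
  by rewrite /sqsum big_map; under eq_bigr do rewrite subrK.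
rewrite !tr; apply: le_trans; rewrite /form big_map le_eqVlt; apply/orP; left.
apply/eqP; congr cabs; apply: eq_bigr => x _; rewrite big_map.
by apply: eq_bigr => y _; rewrite !subrK.
Qed.

(** The Schur test: a matrix dominated by the convolution kernel [w] has all row and column sums at
    most the mass of [w]. Each product |u||v| is replaced by the mean of squares, and the two halves
    are summed along rows and along columns. *)
Lemma Bnd_fin K (w : Gam p -> R) t : uniq t -> (forall z, z \notin t -> w z = 0) ->
  (forall x y, cabs (K x y) <= w (x - y)) -> Bnd K (\sum_(z <- t) w z).
Proof.
move=> ut w0 le s u v us.
have wge z : 0 <= w z by rewrite -(subr0 z); apply: le_trans (le z 0); exact: cabs_ge0.
apply: (@le_trans _ _ (\sum_(x <- s) \sum_(y <- s)
    w (x - y) * ((cabs (u x) ^+ 2 + cabs (v y) ^+ 2) / 2))).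
  apply: le_trans (cabs_sum _ _) _; apply: ler_sum => x _.
  apply: le_trans (cabs_sum _ _) _; apply: ler_sum => y _.
  rewrite !cabsM mulrAC (mulrC _ (cabs (K _ _))); apply: ler_pM.
  - exact: cabs_ge0.
  - by rewrite mulr_ge0 // cabs_ge0.
  - exact: le.
  - by have := sqr_ge0 (cabs (u x) - cabs (v y)); rewrite sqrrB; lra.
have -> : \sum_(x <- s) \sum_(y <- s) w (x - y) * ((cabs (u x) ^+ 2 + cabs (v y) ^+ 2) / 2)
   = \sum_(x <- s) (cabs (u x) ^+ 2 / 2) * (\sum_(y <- s) w (x - y))
   + \sum_(y <- s) (cabs (v y) ^+ 2 / 2) * (\sum_(x <- s) w (x - y)).
  under [X in _ = X + _]eq_bigr do rewrite mulr_sumr.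
  under [X in _ = _ + X]eq_bigr do rewrite mulr_sumr.
  rewrite [X in _ = _ + X]exchange_big -big_split; apply: eq_bigr => x _ /=.
  by rewrite -big_split; apply: eq_bigr => y _ /=; field.
have col y : \sum_(x <- s) w (x - y) <= \sum_(z <- t) w z.
  rewrite -(big_map (fun x => x - y) xpredT w); apply: ler_sum_supp => //.
  by rewrite map_inj_uniq //; exact: addIr.
have row x : \sum_(y <- s) w (x - y) <= \sum_(z <- t) w z.
  rewrite -(big_map (fun y => x - y) xpredT w); apply: ler_sum_supp => //.
  by rewrite map_inj_uniq // => a b /addrI /oppr_inj.
rewrite mulrDl mulrDr; apply: lerD; rewrite /sqsum mulr_suml mulr_sumr; apply: ler_sum => x _;
  by rewrite mulrC ler_wpM2r // divr_ge0 // exprn_ge0 // cabs_ge0.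
Qed.

End Bounds.

(** * Schur multipliers from averaged blocks *)

Section Averaging.
Variables (R : realType) (p : nat).
Implicit Types (K : mat R p) (u v : Gam p -> R[i]) (s X Y : seq (Gam p)) (c : R).

Lemma big_restrict (V : nmodType) (F : Gam p -> V) s t : uniq s -> uniq t ->
  {subset s <= t} -> \sum_(x <- t) (if x \in s then F x else 0) = \sum_(x <- s) F x.
Proof.
move=> us ut st; rewrite -big_mkcond -big_filter; apply: perm_big.
apply: uniq_perm; rewrite ?filter_uniq // => x; rewrite mem_filter.
by case xs: (x \in s) => //=; exact: st.
Qed.

(** The correlation of the indicators of [P] and [Y], normalised by the size of [Y]: a smoothed
    indicator of [P]. *)
Definition avg (P : pred (Gam p)) Y (z : Gam p) : R :=
  (count (fun h => P (h + z)) Y)%:R / (size Y)%:R.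

(* A Schur multiplier estimate: [avg P Y (x - y)] is the average over [g] of the
   indicators of [x - g \in P] and [y - g \in Y], and the blocks so obtained
   overlap at most [size X], respectively [size Y], times. *)
Lemma Bnd_avg K c (P : pred (Gam p)) X Y (D : R) :
  uniq X -> uniq Y -> (0 < size Y)%N -> (forall x, P x -> x \in X) ->
  1 <= D -> (size X)%:R <= D * (size Y)%:R ->
  (forall g, Bnd (fun x y => if P (x - g) && (y - g \in Y) then K x y else 0) c) ->
  Bnd (fun x y => creal (avg P Y (x - y)) * K x y) (D * c).
Proof.
move=> uX uY Y0 PX D1 leD B s u v us.
have c0 : 0 <= c by exact: Bnd_ge0 (B 0).
set N := (size Y)%:R : R; have N0 : 0 < N by rewrite ltr0n.
(* Only translations [g] with [y - g] in [Y] for some [y] in [s] contribute on [s], so the average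
   over the group is a finite sum. *)
pose G := undup [seq y - h | y <- s, h <- Y].
have uG : uniq G by exact: undup_uniq.
pose ug g x := if P (x - g) then u x else 0.
pose vg g y := if y - g \in Y then v y else 0.
pose Kg g x y := if P (x - g) && (y - g \in Y) then K x y else 0.
have GY y : y \in s -> perm_eq [seq g <- G | y - g \in Y] [seq y - h | h <- Y].
  move=> ys; apply: uniq_perm; first by rewrite filter_uniq.
    by rewrite map_inj_uniq // => a b /addrI /oppr_inj.
  move=> g; rewrite mem_filter mem_undup; apply/andP/mapP => [[ygY _]|[h hY ->]].
    by exists (y - g) => //; rewrite opprB addrC subrK.
  rewrite opprB addrC subrK; split=> //.
  by apply/allpairsP; exists (y, h).
(* Under [g = y - h] the point [x - g] becomes [h + (x - y)], and each [y] meets exactly as many [g]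
   as [Y] has elements. *)
have avgE x y : y \in s ->
    creal (avg P Y (x - y)) = creal N^-1 * \sum_(g <- G) (P (x - g) && (y - g \in Y))%:R.
  move=> ys; rewrite /avg crealM mulrC; congr (_ * _).
  rewrite (bigID (fun g => y - g \in Y)) /= [X in _ = _ + X]big1 ?addr0; last first.
    by move=> g /negbTE ->; rewrite andbF.
  under eq_bigr => g ygY do rewrite ygY andbT.
  rewrite -big_filter (perm_big _ (GY y ys)) big_map /creal rmorph_nat.
  rewrite -sum1_count big_mkcond natr_sum; apply: eq_bigr => h _ /=.
  by rewrite opprB addrCA; case: (P _).
have -> : form s u (fun x y => creal (avg P Y (x - y)) * K x y) v =
    creal N^-1 * \sum_(g <- G) form s (ug g) (Kg g) (vg g).
  rewrite /form [X in _ = _ * X]exchange_big mulr_sumr; apply: eq_big_seq => x xs.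
  rewrite [X in _ = _ * X]exchange_big mulr_sumr; apply: eq_big_seq => y ys /=.
  rewrite avgE // -!mulrA mulrCA; congr (_ * _).
  rewrite mulr_suml mulr_sumr; apply: eq_bigr => g _; rewrite /ug /vg /Kg.
  by case: (P _); case: (_ \in Y) => /=; rewrite ?mul1r ?mul0r ?mulr0 ?mulrA.
(* The overlap count: the map from [g] to [x - g] is injective and lands in [Z]. *)
have cnt (Q : pred (Gam p)) Z x : uniq Z -> (forall z, Q z -> z \in Z) ->
    \sum_(g <- G) (if Q (x - g) then 1 else 0) <= (size Z)%:R :> R.
  move=> uZ QZ; rewrite -big_mkcond /= (eq_bigr (fun=> 1%:R)) // -natr_sum ler_nat sum1_count -size_filter.
  rewrite -(size_map (fun g => x - g)); apply: uniq_leq_size.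
    by rewrite map_inj_uniq ?filter_uniq // => a b /addrI /oppr_inj.
  by move=> z /mapP [g]; rewrite mem_filter => /andP [Qg _] ->; exact: QZ.
have sqg (Q : pred (Gam p)) Z (h : Gam p -> R[i]) : uniq Z -> (forall z, Q z -> z \in Z) ->
    \sum_(g <- G) sqsum s (fun x => if Q (x - g) then h x else 0) <=
    (size Z)%:R * sqsum s h.
  move=> uZ QZ; rewrite /sqsum exchange_big mulr_sumr; apply: ler_sum => x _ /=.
  apply: le_trans (ler_wpM2r _ (cnt Q Z x uZ QZ)); last first.
    by rewrite exprn_ge0 // cabs_ge0.
  rewrite mulr_suml; apply: ler_sum => g _.
  by case: (Q _); rewrite ?mul1r // cabs0 expr0n mul0r.
rewrite cabsM cabs_creal ger0_norm ?invr_ge0 ?(ltW N0) //.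
rewrite mulrC ler_pdivrMr //.
have le1 : cabs (\sum_(g <- G) form s (ug g) (Kg g) (vg g)) <=
    c / 2 * (\sum_(g <- G) sqsum s (ug g) + \sum_(g <- G) sqsum s (vg g)).
  rewrite -big_split mulr_sumr; apply: le_trans (cabs_sum _ _) _.
  by apply: ler_sum => g _ /=; rewrite -mulrA [2^-1 * _]mulrC; exact: B.
apply: (le_trans le1).
have -> : D * c * ((sqsum s u + sqsum s v) / 2) * N =
   c / 2 * (D * N * sqsum s u + D * N * sqsum s v) by ring.
rewrite ler_wpM2l ?divr_ge0 // lerD //.
  by apply: le_trans (sqg P X u uX PX) _; rewrite ler_wpM2r ?sqsum_ge0.
(* The columns overlap only [size Y] times; [1 <= D] lets the same constant serve rows and
   columns. *)
apply: le_trans (sqg (mem Y) Y v uY _) _; first by [].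
by rewrite ler_wpM2r ?sqsum_ge0 // ler_peMl // ltW.
Qed.

Lemma Bnd_contract K c (P Q : pred (Gam p)) :
  Bnd K c -> Bnd (fun x y => if P x && Q y then K x y else 0) c.
Proof.
have le1 (b : bool) : cabs (b%:R : R[i]) <= 1 by case: b; rewrite ?cabs1 ?cabs0.
move=> B; have := Bnd_diag (fun x => le1 (P x)) (fun y => le1 (Q y)) B.
by apply: eq_Bnd => x y; case: (P _); case: (Q _) => /=; rewrite ?mul1r ?mulr1 ?mul0r ?mulr0.
Qed.

(* Writing [T = D K - K D] for the commutator block, [K = D^-1 T + D^-1 K D] halves
   any a priori bound for [K] up to the contribution of [T]. *)
Lemma Bnd_block K c M (l : Gam p -> R) (P Q : pred (Gam p)) (r : R) : 0 < r ->
  (forall x, P x -> 2 * r <= l x) -> (forall y, Q y -> 0 <= l y <= r) ->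
  Bnd (fun x y => creal (l x - l y) * K x y) c -> Bnd K M ->
  Bnd (fun x y => if P x && Q y then K x y else 0) (c / r).
Proof.
move=> r0 lP lQ BT BK; set K' := fun x y => _.
have c0 := Bnd_ge0 BT; have M0 := Bnd_ge0 BK.
have step b : Bnd K' b -> Bnd K' (c / r / 2 + b / 2).
  move=> Bb.
  (* The diagonals 1/l on [P] and l on [Q], scaled by [2 * r] and [1 / r] to become contractions;
     the product of the two scalings leaves the factor 1/2 in front of [b]. *)
  pose d1 x := if P x then creal (2 * r / l x) else 0.
  pose d2 y := if Q y then creal (l y / r) else 0.
  have d1_le x : cabs (d1 x) <= 1.
    rewrite /d1; case: ifP => [/lP lx|_]; last by rewrite cabs0.
    have lx0 : 0 < l x by apply: lt_le_trans lx; lra.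
    by rewrite cabs_creal ger0_norm ?ler_pdivrMr ?mul1r // divr_ge0 ?(ltW lx0) //; lra.
  have d2_le y : cabs (d2 y) <= 1.
    rewrite /d2; case: ifP => [/lQ /andP [ly0 lyr]|_]; last by rewrite cabs0.
    by rewrite cabs_creal ger0_norm ?ler_pdivrMr ?mul1r // divr_ge0 // ltW.
  have one (y : Gam p) : cabs (1 : R[i]) <= 1 by rewrite cabs1.
  have B1 := Bnd_diag d1_le one (BndZ (creal (2 * r)^-1) (Bnd_contract P Q BT)).
  have B2 := Bnd_diag d1_le d2_le (BndZ (creal 2^-1) Bb).
  have := BndD B1 B2; rewrite !cabs_creal !ger0_norm ?invr_ge0 ?mulr_ge0 ?(ltW r0) //.
  have -> : (2 * r)^-1 * c + 2^-1 * b = c / r / 2 + b / 2 by field; rewrite gt_eqF.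
  apply: eq_Bnd => x y; rewrite /K' /d1 /d2.
  case Px: (P x); case Qy: (Q y) => /=; rewrite ?(mulr0, mul0r, addr0) //.
  have lx0 : 0 < l x by apply: lt_le_trans (lP x Px); rewrite mulr_gt0.
  set w := 2 * r / l x; set w' := (2 * r)^-1.
  (* The coefficient is (l x - l y) / l x + l y / l x = 1. *)
  transitivity (creal (w * w' * (l x - l y) + w / 2 * (l y / r)) * K x y).
    by rewrite !(crealD, crealM, crealN); ring.
  have -> : w * w' * (l x - l y) + w / 2 * (l y / r) = 1.
    by rewrite /w /w'; field; rewrite !gt_eqF.
  by rewrite creal1 mul1r.
(* The map sending b to c/(2r) + b/2 has fixed point c/r and halves the distance to it. The finite
   bound [M] only starts the iteration and disappears in the limit. *)
have iter n : Bnd K' (c / r + M / 2 ^+ n).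
  elim: n => [|n /step].
    rewrite expr0 divr1; apply: Bnd_le (Bnd_contract P Q BK).
    by rewrite lerDr divr_ge0 // ltW.
  apply: Bnd_le; rewrite exprS le_eqVlt; apply/orP; left; apply/eqP.
  by field; rewrite expf_neq0 // gt_eqF.
apply: (@Bnd_lim _ _ K' (c / r)) => e e0.
have [n] : exists n : nat, M / 2 ^+ n <= e.
  exists (Num.Def.archi_bound (M / e)).
  rewrite ler_pdivrMr ?exprn_gt0 // mulrC -ler_pdivrMr //.
  have := archi_boundP (divr_ge0 M0 (ltW e0)); set k := Num.Def.archi_bound _ => lt.
  by apply: ltW (lt_trans lt _); rewrite -natrX ltr_nat ltn_expl.
by move=> le; apply: Bnd_le (iter n); rewrite lerD2l.
Qed.

End Averaging.

(** * Form bounds, composition and the operator norm *)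

Section OperatorNorm.
Variables (R : realType) (p : nat).
Implicit Types (K : mat R p) (u v g : Gam p -> R[i]) (s t : seq (Gam p)) (c : R).

(** Extension by zero to the union of both lists makes a rectangular pairing a square form, to which
    [Bnd] applies. *)
Lemma form_rect K s t u v : uniq s -> uniq t ->
  exists2 r, uniq r & {subset s <= r} /\
  form r (fun x => if x \in t then u x else 0) K (fun y => if y \in s then v y else 0) =
  \sum_(x <- t) u x * \sum_(y <- s) K x y * v y.
Proof.
move=> us ut; exists (undup (s ++ t)); first exact: undup_uniq.
have sr : {subset s <= undup (s ++ t)} by move=> x xs; rewrite mem_undup mem_cat xs.
have tr : {subset t <= undup (s ++ t)} by move=> x xs; rewrite mem_undup mem_cat xs orbT.
split=> //; rewrite /form -(big_restrict _ ut (undup_uniq _) tr).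
apply: eq_bigr => x _; case: (x \in t); last first.
  by rewrite big1 // => y _; rewrite !mul0r.
rewrite -(big_restrict _ us (undup_uniq _) sr) mulr_sumr.
by apply: eq_bigr => y _; case: (y \in s); rewrite ?mulr0 ?mulrA.
Qed.

Lemma sqsum_restrict s r u : uniq s -> uniq r ->
  sqsum r (fun x => if x \in s then u x else 0) <= sqsum s u.
Proof.
move=> us ur; rewrite -(@eq_sqsum _ _ s (fun x => if x \in s then u x else 0)).
  by apply: sqsum_supp => // x /negbTE ->.
by move=> x ->.
Qed.

Lemma Bnd_rect K c s t u v : Bnd K c -> uniq s -> uniq t ->
  cabs (\sum_(x <- t) u x * \sum_(y <- s) K x y * v y) <=
  c * ((sqsum t u + sqsum s v) / 2).
Proof.
move=> B us ut; have [r ur [_ <-]] := form_rect K u v us ut.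
apply: le_trans (B _ _ _ ur) _; rewrite ler_wpM2l ?(Bnd_ge0 B) // ler_wpM2r //.
by rewrite lerD // sqsum_restrict.
Qed.

(** Testing the form on [a] times the conjugate of w = Kv gives a |w|^2 <= c (a^2 |w|^2 + |v|^2) /
    2. The optimal choice is a = 1/c; for c = 0 the choice a = 1 already forces w = 0. *)
Lemma Bnd_app K c s t v : Bnd K c -> uniq s -> uniq t ->
  sqsum t (fun x => \sum_(y <- s) K x y * v y) <= c ^+ 2 * sqsum s v.
Proof.
move=> B us ut; set w := fun x => _.
have ineq (a : R) : 0 <= a -> a * sqsum t w <= c * ((a ^+ 2 * sqsum t w + sqsum s v) / 2).
  move=> a0; have := Bnd_rect (fun x => creal a * conjc (w x)) v B us ut.
  have -> : \sum_(x <- t) creal a * conjc (w x) * w x = creal (a * sqsum t w).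
    rewrite crealM /sqsum creal_sum mulr_sumr; apply: eq_bigr => x _.
    by rewrite -mulrA [_^*%C * _]mulrC mulcc.
  rewrite cabs_creal ger0_norm ?mulr_ge0 ?sqsum_ge0 // sqsumZ cabs_creal.
  by rewrite ger0_norm // (sqsum_conj t w).
have c0 := Bnd_ge0 B; have [c00|cn0] := eqVneq c 0.
  by have := ineq 1 ler01; rewrite c00 mul0r expr0n mul0r mul1r.
have cp : 0 < c by rewrite lt_def cn0.
have := ineq c^-1; rewrite invr_ge0 => /(_ c0).
have -> : c * ((c^-1 ^+ 2 * sqsum t w + sqsum s v) / 2) =
  c^-1 * ((sqsum t w + c ^+ 2 * sqsum s v) / 2) by field.
by rewrite ler_pM2l ?invr_gt0 //; lra.
Qed.

(** The form of the product pairs [u] with [K1] applied to [K2 v], the latter rescaled to be no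
    longer than [v]. For each finite set of columns the product is a sum over one finite list, so no
    convergence is involved. *)
Lemma Bnd_comp K1 K2 K c1 c2 : Bnd K1 c1 -> Bnd K2 c2 ->
  (forall s, exists2 t, uniq t & forall x y, y \in s ->
    K x y = \sum_(z <- t) K1 x z * K2 z y) ->
  Bnd K (c1 * c2).
Proof.
move=> B1 B2 fac; have c10 := Bnd_ge0 B1; have c20 := Bnd_ge0 B2.
(* Rescaling divides by the bound of [K2], which may be 0; a positive [c] replaces it and then tends
   to [c2]. *)
have pos c : 0 < c -> c2 <= c -> Bnd K (c1 * c).
  move=> cp lec s u v us; have [t ut Kt] := fac s.
  pose w z := \sum_(y <- s) K2 z y * v y.
  have -> : form s u K v = creal c * \sum_(x <- s) u x * \sum_(z <- t) K1 x z * (creal c^-1 * w z).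
    rewrite /form mulr_sumr; apply: eq_bigr => x _.
    transitivity (u x * \sum_(z <- t) K1 x z * w z).
      rewrite mulr_sumr; under [RHS]eq_bigr do rewrite /w 2!mulr_sumr.
      rewrite exchange_big; apply: eq_big_seq => y ys /=; rewrite Kt //.
      by rewrite mulr_sumr mulr_suml; apply: eq_bigr => z _; rewrite !mulrA.
    rewrite mulrCA; congr (_ * _); rewrite mulr_sumr; apply: eq_bigr => z _.
    by rewrite mulrCA [creal c * _]mulrA -crealM divff ?gt_eqF ?creal1 ?mul1r.
  rewrite cabsM cabs_creal gtr0_norm //.
  have := Bnd_rect u (fun z => creal c^-1 * w z) B1 ut us.
  rewrite sqsumZ cabs_creal ger0_norm ?invr_ge0 ?(ltW cp) // => le.
  have lew : c^-1 ^+ 2 * sqsum t w <= sqsum s v.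
    rewrite exprVn mulrC ler_pdivrMr ?exprn_gt0 //.
    apply: le_trans (Bnd_app v B2 us ut) _; rewrite mulrC ler_wpM2l ?sqsum_ge0 //.
    by rewrite lerXn2r ?nnegrE // ltW.
  rewrite mulrC mulrAC ler_wpM2r ?(ltW cp) //; apply: le_trans le _.
  by rewrite ler_wpM2l // ler_wpM2r // lerD2l.
apply: Bnd_lim => e e0.
have c11 : 0 < c1 + 1 by lra.
apply: Bnd_le (pos (c2 + e / (c1 + 1)) _ _).
- rewrite mulrDr lerD2l mulrCA ger_pMr // ler_pdivrMr //; lra.
- by have := divr_gt0 e0 c11; lra.
- by have := divr_gt0 e0 c11; lra.
Qed.

Lemma opnorm_ge0 K : (0 <= opnorm K)%E.
Proof.
apply: (le_trans (l2norm_ge0 (mapp K (fun=> 0)))); apply: ereal_sup_ubound.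
exists (fun=> 0) => //; split; first by apply: (@finsupp_seq _ _ [::]).
by apply/l2norm_leP => // s _; rewrite /sqsum big1 // => x _; rewrite cabs0 expr0n.
Qed.

(** Bounds on the extended-real operator norm become bounds on finite forms. From right to left this
    is [Bnd_app]; conversely [v] is normalised to a unit vector and the pairing is split by a
    weighted inequality of means. *)
Lemma opnormP K c : (opnorm K <= c%:E)%E <-> Bnd K c.
Proof.
split=> [le|B]; last first.
  apply: ge_ereal_sup => _ [g [fg g1] <-].
  have [s us g0] := finsuppP fg; apply/l2norm_leP; first exact: Bnd_ge0 B.
  move=> t ut; rewrite (@eq_sqsum _ _ _ _ (fun x => \sum_(y <- s) K x y * g y)); last first.
    by move=> x _; rewrite (mappE _ _ us).
  apply: le_trans (Bnd_app g B us ut) _; rewrite ler_piMr ?sqr_ge0 //.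
  by have := (l2norm_leP g ler01).1 g1 s us; rewrite expr1n.
have c0 : 0 <= c by rewrite -lee_fin (le_trans (opnorm_ge0 K)).
apply: Bnd_lim => e e0; set b := c + e.
have b0 : 0 < b by rewrite /b; lra.
move=> s u v us; rewrite form_delta //; pose v' y := if y \in s then v y else 0; rewrite -/v'.
have sv : sqsum s v' = sqsum s v by apply: eq_sqsum => x xs; rewrite /v' xs.
have v'0 x : x \notin s -> v' x = 0 by rewrite /v' => /negbTE ->.
(* A zero vector cannot be normalised, but its form vanishes. *)
have [nu0|nu_neq0] := eqVneq (sqsum s v) 0.
  rewrite big1 ?cabs0.
    by rewrite mulr_ge0 ?(ltW b0) // divr_ge0 // addr_ge0 ?sqsum_ge0.
  move=> x _; rewrite (mappE _ _ us) // big_seq big1 ?mulr0 // => y ys.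
  have /eqP := nu0; rewrite -sv psumr_eq0; last by move=> i _; rewrite exprn_ge0 ?cabs_ge0.
  move=> /allP /(_ y ys) /=; rewrite expf_eq0 /= cabs_eq0 => /eqP ->.
  by rewrite mulr0.
have nup : 0 < sqsum s v by rewrite lt_def nu_neq0 sqsum_ge0.
set nu := Num.sqrt (sqsum s v); have nu0 : 0 < nu by rewrite sqrtr_gt0.
have nu2 : nu ^+ 2 = sqsum s v by rewrite sqr_sqrtr // ltW.
pose g y := creal nu^-1 * v' y.
have g0 x : x \notin s -> g x = 0 by rewrite /g => /v'0 ->; rewrite mulr0.
have g1 : (l2norm g <= 1%:E)%E.
  apply/l2norm_leP => // t ut; apply: le_trans (sqsum_supp us ut g0) _.
  rewrite sqsumZ cabs_creal sv -nu2 ger0_norm ?invr_ge0 ?(ltW nu0) //.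
  by rewrite -exprMn mulVf ?gt_eqF.
have : (l2norm (mapp K g) <= b%:E)%E.
  apply: (@le_trans _ _ (opnorm K)); last first.
    by apply: le_trans le _; rewrite lee_fin /b lerDl ltW.
  by apply: ereal_sup_ubound; exists g => //; split=> //; exact: finsupp_seq g0.
move=> /(l2norm_leP _ (ltW b0)) /(_ s us) leb.
have -> : \sum_(x <- s) u x * mapp K v' x = creal nu * \sum_(x <- s) u x * mapp K g x.
  rewrite mulr_sumr; apply: eq_bigr => x _; rewrite mulrCA; congr (_ * _).
  rewrite !(mappE _ _ us) // mulr_sumr; apply: eq_bigr => y _.
  by rewrite /g mulrCA [creal nu * _]mulrA -crealM divff ?gt_eqF // creal1 mul1r.
rewrite cabsM cabs_creal (gtr0_norm nu0).
(* The weights make the second half at most [b / 2] times the square norm of [v], because the image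
   of the unit vector [g] has norm at most [b]; the slack [e] keeps [b] positive. *)
apply: (@le_trans _ _ (\sum_(x <- s) (b / 2 * cabs (u x) ^+ 2 +
    nu ^+ 2 / b / 2 * cabs (mapp K g x) ^+ 2))).
  rewrite mulrC -ler_pdivlMr //; apply: le_trans (cabs_sum _ _) _.
  rewrite mulr_suml; apply: ler_sum => x _; rewrite cabsM ler_pdivlMr //.
  have := sqr_ge0 (b * cabs (u x) - nu * cabs (mapp K g x)); set A := cabs (u x); set C := cabs _.
  move=> q0; rewrite -subr_ge0.
  have -> : b / 2 * A ^+ 2 + nu ^+ 2 / b / 2 * C ^+ 2 - A * C * nu =
    (b * A - nu * C) ^+ 2 / (2 * b) by field; rewrite gt_eqF.
  by rewrite divr_ge0 // mulr_ge0 // ltW.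
rewrite big_split /= -!mulr_sumr -/(sqsum s u) -/(sqsum s (mapp K g)).
have -> : b * ((sqsum s u + sqsum s v) / 2) = b / 2 * sqsum s u + b / 2 * sqsum s v by ring.
rewrite lerD2l.
apply: le_trans (ler_wpM2l _ leb) _; first by rewrite !divr_ge0 ?exprn_ge0 // ltW.
rewrite nu2 le_eqVlt; apply/orP; left; apply/eqP; by field; rewrite gt_eqF.
Qed.

Lemma opnorm_ltP K c : (opnorm K < c%:E)%E <-> exists2 b, Bnd K b & b < c.
Proof.
split=> [lt|[b /opnormP B lt]]; last by apply: le_lt_trans B _; rewrite lte_fin.
have := opnorm_ge0 K; case E : (opnorm K) lt => [b| |] //; rewrite lte_fin => lt _.
by exists b => //; apply/opnormP; rewrite E.
Qed.

Lemma Bnd_opnorm K c : Bnd K c -> exists2 b, opnorm K = b%:E & Bnd K b.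
Proof.
move=> /opnormP; have := opnorm_ge0 K; case E : (opnorm K) => [b| |] // _ _.
by exists b => //; apply/opnormP; rewrite E.
Qed.

End OperatorNorm.

(** * The cocycle on pairs of p-adic fractions *)

Section Fractions.
Variable p : nat.
Hypothesis p_pr : prime p.
Implicit Types r s : Z1p p.

Lemma intr_pow n : ((p ^ n)%N%:Z)%:~R = (p%:Q) ^+ n.
Proof. by rewrite -!pmulrn natrX. Qed.

Lemma pq_neq0 n : (p%:Q) ^+ n != 0.
Proof. by rewrite expf_neq0 // intr_eq0 -lt0n prime_gt0. Qed.

(** The reduced denominator is coprime to the numerator, so it divides a power of [p] and is itself
    one. *)
Lemma Z1p_denq r : denq (val r) = (p ^ kexp r)%N%:Z.
Proof.
case: r => r /= hr; rewrite /kexp /=; case/asboolP: (hr) => k [z rk].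
have dvd : (`|denq r| %| p ^ k)%N.
  have : (`|denq r| %| `|numq r| * p ^ k)%N.
    have e : numq r * (p ^ k)%N%:Z = z * denq r.
      apply: (@intr_inj rat); rewrite !rmorphM /= numqE -rk intr_pow; ring.
    apply/dvdnP; exists `|z|%N; have := congr1 absz e.
    by rewrite !abszM.
  by rewrite mulnC Gauss_dvdl // coprime_sym coprime_num_den.
have /(dvdn_pfactor _ _ p_pr) [m _ e] := dvd.
by rewrite -absz_denq e pfactorK.
Qed.

Lemma Z1p_canon r : val r * (p%:Q) ^+ kexp r = (qnum r)%:~R.
Proof. by rewrite /qnum numqE Z1p_denq intr_pow. Qed.

Lemma Z1p_numer r n : (kexp r <= n)%N ->
  val r * (p%:Q) ^+ n = (qnum r * (p ^ (n - kexp r))%N%:Z)%:~R.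
Proof.
by move=> le; rewrite -[in LHS](subnKC le) exprD mulrA Z1p_canon rmorphM /= intr_pow.
Qed.

(** By coprimality the reduced denominator divides p^n, so any representation over a power of [p] is
    the reduced one expanded. *)
Lemma Z1p_numerP r n (a : int) : val r * (p%:Q) ^+ n = a%:~R ->
  (kexp r <= n)%N /\ a = qnum r * (p ^ (n - kexp r))%N%:Z.
Proof.
move=> ra; have le : (kexp r <= n)%N.
  rewrite -(dvdn_Pexp2l _ _ (prime_gt1 p_pr)).
  have : (p ^ kexp r %| `|numq (val r)| * p ^ n)%N.
    have e : numq (val r) * (p ^ n)%N%:Z = a * denq (val r).
      apply: (@intr_inj rat); rewrite !rmorphM /= numqE -ra intr_pow; exact: mulrAC.
    apply/dvdnP; exists `|a|%N; have := congr1 absz e.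
    by rewrite !abszM Z1p_denq.
  rewrite Gauss_dvdr // -[(p ^ kexp r)%N]absz_nat -Z1p_denq coprime_sym.
  exact: coprime_num_den.
split=> //; apply: (@intr_inj rat); rewrite -ra; exact: Z1p_numer.
Qed.

Lemma Z1p_pred_frac (a : int) n : Z1p_pred p (a%:~R / (p%:Q) ^+ n).
Proof. by apply/asboolP; exists n, a; rewrite mulfVK // pq_neq0. Qed.

End Fractions.

(** * The cocycle is a unimodular bicharacter *)

Section Cocycle.
Variables (R : realType) (p : nat) (theta : nat -> R).
Hypothesis p_pr : prime p.
Hypothesis thetaO : Omega p theta.
Implicit Types x y z : Gam p.

Lemma cexpiD (s t : R) : cexpi (s + t) = cexpi s * cexpi t.
Proof.
rewrite /cexpi cosD sinD; apply/eqP; rewrite eq_complex /=.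
by apply/andP; split; apply/eqP; ring.
Qed.

Lemma cexpi0 : cexpi (0 : R) = 1.
Proof. by rewrite /cexpi cos0 sin0. Qed.

Lemma cexpi_int (k : int) : cexpi (2 * pi * k%:~R : R) = 1.
Proof.
have nat1 (n : nat) : cexpi (2 * pi * n%:R : R) = 1.
  have -> : 2 * pi * n%:R = 0 + (pi *+ 2) *+ n :> R
    by rewrite add0r -[RHS]mulr_natr -[pi *+ 2]mulr_natl.
  rewrite /cexpi (periodicn (@cosD2pi R)) (periodicn (@sinD2pi R)).
  by rewrite cos0 sin0.
case: k => n; first exact: nat1.
have := cexpiD (2 * pi * n.+1%:R) (2 * pi * (Negz n)%:~R).
by rewrite nat1 mul1r NegzE mulrNz mulrN subrr cexpi0 => <-.
Qed.

Lemma Omega_shift n j : exists k : int, (p ^ j)%:R * theta (n + j) = theta n + k%:~R.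
Proof.
elim: j => [|j [k ih]]; first by exists 0; rewrite expn0 mul1r addn0 addr0.
have [z hz] := thetaO.2 (n + j)%N.
exists (k + z * (p ^ j)%N%:Z); rewrite addnS expnS natrM mulrAC.
have -> : p%:R * theta (n + j).+1 = theta (n + j) + z%:~R by rewrite -hz addrC subrK.
rewrite mulrDl mulrC ih rmorphD rmorphM /= -pmulrn; ring.
Qed.

(* [theta_N a b] may be computed from any fractions representing the entries, because
   [p theta_(n+1) = theta_n] modulo 1. *)
Lemma sigmaE x y n m (a b : int) :
  val x.1 * (p%:Q) ^+ n = a%:~R -> val y.2 * (p%:Q) ^+ m = b%:~R ->
  sigma theta x y = cexpi (2 * pi * theta (n + m)%N * (a * b)%:~R).
Proof.
move=> /(Z1p_numerP p_pr) [len ->] /(Z1p_numerP p_pr) [lem ->]; rewrite /sigma.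
set i := kexp _; set j := kexp _; set q := qnum _ * qnum _.
have [k hk] := Omega_shift (i + j) (n - i + (m - j)).
have e : ((i + j) + (n - i + (m - j)) = n + m)%N.
  by rewrite addnACA (subnKC len) (subnKC lem).
rewrite e in hk.
have -> : qnum x.1 * (p ^ (n - i))%N%:Z * (qnum y.2 * (p ^ (m - j))%N%:Z) =
  q * (p ^ (n - i + (m - j)))%N%:Z by rewrite expnD PoszM mulrACA.
have -> : 2 * pi * theta (n + m)%N * (q * (p ^ (n - i + (m - j)))%N%:Z)%:~R =
    2 * pi * theta (i + j)%N * q%:~R + 2 * pi * (k * q)%:~R.
  transitivity (2 * pi * ((p ^ (n - i + (m - j)))%:R * theta (n + m)%N) * q%:~R).
    rewrite intrM -(pmulrn 1 (p ^ _)).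
    by move: ((p ^ _)%:R) (q%:~R) => P Q; ring.
  by rewrite hk intrM; move: (q%:~R) => Q; ring.
by rewrite cexpiD cexpi_int mulr1.
Qed.

Lemma Z1p_common (r s : Z1p p) : exists n (a b : int),
  val r * (p%:Q) ^+ n = a%:~R /\ val s * (p%:Q) ^+ n = b%:~R.
Proof.
exists (kexp r + kexp s)%N; eexists; eexists; split; apply: Z1p_numer => //.
  exact: leq_addr.
exact: leq_addl.
Qed.

(** Over a common denominator the numerators add, and [sigmaE] allows all three values to be
    computed there with the same entry of [theta]. *)
Lemma sigmaDl x x' y : sigma theta (x + x') y = sigma theta x y * sigma theta x' y.
Proof.
have [n [a [a' [ha ha']]]] := Z1p_common x.1 x'.1.
have hb := Z1p_canon p_pr y.2.
rewrite (sigmaE ha hb) (sigmaE ha' hb) (@sigmaE _ _ n _ (a + a') _ _ hb).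
  by rewrite -cexpiD; congr cexpi; rewrite !rmorphM /= rmorphD /=; ring.
by rewrite /= mulrDl ha ha' rmorphD.
Qed.

Lemma sigmaDr x y y' : sigma theta x (y + y') = sigma theta x y * sigma theta x y'.
Proof.
have [n [b [b' [hb hb']]]] := Z1p_common y.2 y'.2.
have ha := Z1p_canon p_pr x.1.
rewrite (sigmaE ha hb) (sigmaE ha hb') (@sigmaE _ _ _ n _ (b + b') ha).
  by rewrite -cexpiD; congr cexpi; rewrite !rmorphM /= rmorphD /=; ring.
by rewrite /= mulrDl hb hb' rmorphD.
Qed.

Lemma cabs_sigma x y : cabs (sigma theta x y) = 1.
Proof. exact: cabs_cexpi. Qed.

Lemma sigma_neq0 x y : sigma theta x y != 0.
Proof. by rewrite -cabs_eq0 cabs_sigma oner_eq0. Qed.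

Lemma sigma0l y : sigma theta 0 y = 1.
Proof. by apply: (mulfI (sigma_neq0 0 y)); rewrite -sigmaDl addr0 mulr1. Qed.

Lemma sigma0r x : sigma theta x 0 = 1.
Proof. by apply: (mulfI (sigma_neq0 x 0)); rewrite -sigmaDr addr0 mulr1. Qed.

Lemma sigmaNl x y : sigma theta (- x) y = conjc (sigma theta x y).
Proof.
apply: (mulfI (sigma_neq0 x y)); rewrite -sigmaDl subrr sigma0l mulcc cabs_sigma.
by rewrite expr1n creal1.
Qed.

Lemma sigmaNr x y : sigma theta x (- y) = conjc (sigma theta x y).
Proof.
apply: (mulfI (sigma_neq0 x y)); rewrite -sigmaDr subrr sigma0r mulcc cabs_sigma.
by rewrite expr1n creal1.
Qed.

Lemma sigmaM_conj x y : sigma theta x y * conjc (sigma theta x y) = 1.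
Proof. by rewrite mulcc cabs_sigma expr1n creal1. Qed.

End Cocycle.

(** * The length function and the boxes *)

Section Length.
Variables (R : realType) (p : nat).
Hypothesis p_pr : prime p.
Implicit Types (r s : Z1p p) (x y : Gam p).

Let p0 : 0 < p%:R :> R. Proof. by rewrite ltr0n prime_gt0. Qed.
Let p1 : 1 <= p%:R :> R. Proof. by rewrite ler1n prime_gt0. Qed.

Lemma padic_ge0 q : 0 <= padic_norm R p q.
Proof. by rewrite /padic_norm; case: ifP => // _; rewrite divr_ge0 ?exprn_ge0 ?(ltW p0). Qed.

Lemma padicN q : padic_norm R p (- q) = padic_norm R p q.
Proof. by rewrite /padic_norm oppr_eq0 numqN denqN abszN. Qed.

(** Expanding a fraction by powers of [p] raises the exponent and the valuation of the numerator
    equally, so any representation computes the norm. *)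
Lemma padic_frac r n (a : int) : a != 0 -> val r * (p%:Q) ^+ n = a%:~R ->
  padic_norm R p (val r) = p%:R ^+ n / p%:R ^+ logn p `|a|.
Proof.
move=> a0 ra; have r0 : val r != 0.
  by apply: contra_neq a0 => r0; apply: (@intr_inj rat); rewrite -ra r0 mul0r.
have [le aE] := Z1p_numerP p_pr ra.
have q0 : (0 < `|qnum r|)%N by rewrite absz_gt0 numq_eq0.
rewrite /padic_norm (negbTE r0) aE abszM absz_nat lognM ?expn_gt0 ?(prime_gt0 p_pr) //.
rewrite pfactorK // exprD -/(kexp r) -/(qnum r).
have -> : p%:R ^+ n = p%:R ^+ kexp r * p%:R ^+ (n - kexp r) :> R.
  by rewrite -exprD subnKC.
by field; rewrite !expf_neq0 // gt_eqF.
Qed.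

(** Over a common denominator this follows from the ultrametric inequality for valuations. Zero
    numerators are treated apart since [logn p 0] is 0 rather than infinite. *)
Lemma padicD r s : padic_norm R p (val (r + s)) <=
  padic_norm R p (val r) + padic_norm R p (val s).
Proof.
have [n [a [b [ha hb]]]] := Z1p_common p_pr r s.
have hab : val (r + s) * (p%:Q) ^+ n = (a + b)%:~R by rewrite /= mulrDl ha hb rmorphD.
have eq0 (t : Z1p p) (c : int) : val t * (p%:Q) ^+ n = c%:~R -> c = 0 -> val t = 0 :> rat.
  by move=> + c0 => /eqP; rewrite c0 mulf_eq0 (negbTE (pq_neq0 p_pr n)) orbF => /eqP.
have [a0|a0] := eqVneq a 0.
  by rewrite /= (eq0 _ _ ha a0) add0r lerDr padic_ge0.
have [b0|b0] := eqVneq b 0.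
  by rewrite /= (eq0 _ _ hb b0) addr0 lerDl padic_ge0.
have [ab0|ab0] := eqVneq (a + b) 0.
  by rewrite (eq0 _ _ hab ab0) {1}/padic_norm eqxx addr_ge0 ?padic_ge0.
rewrite (padic_frac a0 ha) (padic_frac b0 hb) (padic_frac ab0 hab).
set A := logn p `|a|; set B := logn p `|b|; set C := logn p `|a + b|.
have le : (minn A B <= C)%N.
  rewrite /C -pfactor_dvdn ?absz_gt0 //.
  have : ((p ^ minn A B)%N%:Z %| a + b)%Z.
    by apply: rpredD; rewrite dvdzE !absz_nat pfactor_dvdn ?absz_gt0 ?geq_minl ?geq_minr.
  by rewrite dvdzE absz_nat.
have mono m : (m <= C)%N -> p%:R ^+ n / p%:R ^+ C <= p%:R ^+ n / p%:R ^+ m :> R.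
  move=> mC; rewrite ler_wpM2l ?exprn_ge0 ?(ltW p0) // lef_pV2 ?posrE ?exprn_gt0 //.
  exact: ler_weXn2l.
have ge0 m : 0 <= p%:R ^+ n / p%:R ^+ m :> R by rewrite divr_ge0 ?exprn_ge0 ?(ltW p0).
have := le; rewrite geq_min => /orP [] /mono {}le.
  by rewrite -[leLHS]addr0 lerD.
by rewrite -[leLHS]add0r lerD.
Qed.

Lemma Lp_ge0 r : 0 <= Lp R r.
Proof. by rewrite addr_ge0 // padic_ge0. Qed.

Lemma LSig_ge0 x : 0 <= LSig R x.
Proof. by rewrite addr_ge0 // Lp_ge0. Qed.

Lemma LpN r : Lp R (- r) = Lp R r.
Proof. by rewrite /Lp /= rmorphN normrN padicN. Qed.

Lemma LSigN x : LSig R (- x) = LSig R x.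
Proof. by rewrite /LSig -(LpN x.1) -(LpN x.2). Qed.

Lemma LpD r s : Lp R (r + s) <= Lp R r + Lp R s.
Proof.
rewrite /Lp [leRHS]addrACA lerD ?padicD //=.
by rewrite rmorphD ler_normD.
Qed.

Lemma LSigD x y : LSig R (x + y) <= LSig R x + LSig R y.
Proof. by rewrite /LSig [leRHS]addrACA; apply: lerD; exact: LpD. Qed.

Lemma LSig_lip x y : `|LSig R x - LSig R y| <= LSig R (x - y).
Proof.
rewrite ler_norml; apply/andP; split.
  have := LSigD (y - x) x; rewrite subrK -(LSigN (y - x)) opprB; lra.
by have := LSigD (x - y) y; rewrite subrK; lra.
Qed.

Lemma LSig0 : LSig R (0 : Gam p) = 0.
Proof. by rewrite /LSig /Lp /padic_norm /= ?eqxx rmorph0 normr0 !addr0. Qed.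

Lemma Lp_eq0 r : Lp R r = 0 -> r = 0.
Proof.
move/eqP; rewrite paddr_eq0 // ?padic_ge0 // => /andP [/eqP /normr0_eq0 /eqP].
by rewrite fmorph_eq0 => /eqP r0 _; apply/val_inj.
Qed.

Lemma LSig_eq0 x : LSig R x = 0 -> x = 0.
Proof.
case: x => a b /eqP; rewrite paddr_eq0 ?Lp_ge0 // => /andP [/eqP /Lp_eq0 /= -> /eqP].
by move=> /Lp_eq0 /= ->.
Qed.

Lemma LSig_gt0 x : x != 0 -> 0 < LSig R x.
Proof. by move=> x0; rewrite lt_def LSig_ge0 andbT; apply: contra_neq x0 => /LSig_eq0. Qed.

End Length.

(** * Boxes of fractions: growth, sums and comparison with balls *)

Section Boxes.
Variables (R : realType) (p : nat).
Hypothesis p_pr : prime p.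
Implicit Types (r s : Z1p p) (x y : Gam p).

(** The numerators run from -p^(2n) to p^(2n), whence absolute value at most p^n. The default 0 of
    [insubd] is never taken, because these fractions lie in Z[1/p] for prime [p]. *)
Definition interval1 n : seq (Z1p p) :=
  [seq insubd (0 : Z1p p) ((i%:Z - (p ^ (n + n))%N%:Z)%:~R / (p%:Q) ^+ n)
  | i : nat <- iota 0 (p ^ (n + n)).*2.+1].

Definition box n : seq (Gam p) := [seq (a, b) | a <- interval1 n, b <- interval1 n].

Lemma val_interval1 n (a : int) :
  val (insubd (0 : Z1p p) (a%:~R / (p%:Q) ^+ n)) = a%:~R / (p%:Q) ^+ n.
Proof. by rewrite insubdK //; exact: Z1p_pred_frac. Qed.

Lemma interval1P n r :
  reflect (exists2 a : int, val r * (p%:Q) ^+ n = a%:~R & `|a| <= (p ^ (n + n))%N%:Z)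
          (r \in interval1 n).
Proof.
apply: (iffP mapP) => [[i +]|[a ra lea]].
  rewrite mem_iota => /andP [_ lti] ->.
  exists (i%:Z - (p ^ (n + n))%N%:Z); first by rewrite val_interval1 mulfVK // pq_neq0.
  move: (p ^ (n + n))%N lti => P; lia.
exists (absz (a + (p ^ (n + n))%N%:Z)).
  by rewrite mem_iota; move: (p ^ (n + n))%N lea => P; lia.
have -> : (absz (a + (p ^ (n + n))%N%:Z))%:Z - (p ^ (n + n))%N%:Z = a.
  by move: (p ^ (n + n))%N lea => P; lia.
by apply/val_inj; rewrite val_interval1 -ra mulfK // pq_neq0.
Qed.

Lemma interval1_uniq n : uniq (interval1 n).
Proof.
rewrite map_inj_in_uniq ?iota_uniq // => i j _ _ /(congr1 val).
rewrite !val_interval1 => /(mulIf _) -/(_ _)/intr_inj.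
by rewrite invr_eq0 pq_neq0 // => /(_ isT) /addIr [].
Qed.

Lemma box_uniq n : uniq (box n).
Proof. by apply: allpairs_uniq; rewrite ?interval1_uniq // => -[a b] [c d]. Qed.

Lemma mem_box n x : (x \in box n) = (x.1 \in interval1 n) && (x.2 \in interval1 n).
Proof.
by apply/allpairsP/andP => [[[a b] [/= ? ? ->]]|[h1 h2]] //; exists x; case: x h1 h2.
Qed.

Lemma size_box n : size (box n) = ((p ^ (n + n)).*2.+1 ^ 2)%N.
Proof. by rewrite size_allpairs size_map size_iota. Qed.

Lemma size_box_gt0 n : (0 < size (box n))%N.
Proof. by rewrite size_box expn_gt0. Qed.

(** In one coordinate, 2PQ + 1 <= Q(2P + 1) with P = p^(2n) and Q = p^(2j); squaring gives the
    factor p^(4j). *)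
Lemma size_box_ratio n j :
  (size (box (n + j)))%:R <= (p ^ (4 * j))%:R * (size (box n))%:R :> R.
Proof.
rewrite -natrM ler_nat !size_box.
have -> : (4 * j = (j + j) * 2)%N by lia.
rewrite expnM -expnMn leq_exp2r // addnACA expnD.
have : (0 < p ^ (j + j))%N by rewrite expn_gt0 prime_gt0.
move: (p ^ (n + n))%N (p ^ (j + j))%N => P Q; nia.
Qed.

Lemma interval1_le m n : (m <= n)%N -> {subset interval1 m <= interval1 n}.
Proof.
move=> le r /interval1P [a ra lea]; apply/interval1P.
exists (a * (p ^ (n - m))%N%:Z).
  by rewrite -(subnKC le) exprD mulrA ra rmorphM /= intr_pow (subnKC le).
have leT : (p ^ (m + m) * p ^ (n - m) <= p ^ (n + n))%N.
  by rewrite -expnD leq_exp2l ?prime_gt1 //; lia.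
rewrite normrM [`|Posz _|]ger0_norm //; apply: le_trans (_ : (p ^ (m + m) * p ^ (n - m))%N%:Z <= _); last by rewrite lez_nat.
by rewrite PoszM ler_wpM2r.
Qed.

(** Over p^(m+1) the numerator of the sum is at most 2p p^(2m) <= p^(2(m+1)) as p >= 2; each
    addition costs one level. *)
Lemma interval1D m n r s : (m < n)%N -> r \in interval1 m -> s \in interval1 m ->
  r + s \in interval1 n.
Proof.
move=> lt /interval1P [a ra lea] /interval1P [b sb leb].
apply: (interval1_le lt); apply/interval1P; exists ((a + b) * p%:Z).
  by rewrite exprSr mulrA /= mulrDl ra sb -rmorphD -rmorphM.
rewrite normrM [`|p%:Z|]ger0_norm // addSn addnS !expnS.
have := prime_gt1 p_pr; move: (p ^ (m + m))%N lea leb => P; nia.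
Qed.

Lemma interval1N n r : r \in interval1 n -> - r \in interval1 n.
Proof.
move=> /interval1P [a ra lea]; apply/interval1P; exists (- a); rewrite ?normrN //.
by rewrite /= mulNr ra rmorphN.
Qed.

Lemma box_le m n : (m <= n)%N -> {subset box m <= box n}.
Proof. by move=> le x; rewrite !mem_box => /andP [? ?]; rewrite !(interval1_le le). Qed.

Lemma boxD m n k x y : (m < k)%N -> (n < k)%N -> x \in box m -> y \in box n ->
  x + y \in box k.
Proof.
move=> mk nk xm yn; have := box_le (leq_maxl m n) xm; have := box_le (leq_maxr m n) yn.
have lt : (maxn m n < k)%N by rewrite gtn_max mk nk.
by rewrite !mem_box => /andP [? ?] /andP [? ?]; rewrite !(interval1D lt).
Qed.

Lemma boxN n x : x \in box n -> - x \in box n.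
Proof. by rewrite !mem_box => /andP [? ?]; rewrite !interval1N. Qed.

Lemma Lp_interval1 n r : r \in interval1 n -> Lp R r <= 2 * p%:R ^+ n.
Proof.
move=> /interval1P [a ra lea].
have pn0 : 0 < p%:R ^+ n :> R by rewrite exprn_gt0 // ltr0n prime_gt0.
rewrite /Lp mulrDl !mul1r lerD //.
  have -> : ratr (val r) = a%:~R / p%:R ^+ n :> R.
    apply: (canRL (mulfK (lt0r_neq0 pn0))).
    rewrite -(ratr_int _ a) -ra rmorphM /= rmorphXn /= ratr_int.
    by rewrite -pmulrn.
  rewrite normrM normfV [`|p%:R ^+ n|]gtr0_norm // ler_pdivrMr // -exprD.
  by rewrite -natrX -intr_norm -[leRHS]/((p ^ (n + n))%N%:Z%:~R) ler_int.
have [a0|a0] := eqVneq a 0.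
  have -> : val r = 0.
    by move/eqP: ra; rewrite a0 mulf_eq0 (negbTE (pq_neq0 p_pr n)) orbF => /eqP.
  by rewrite /padic_norm eqxx ltW.
rewrite (padic_frac R p_pr a0 ra) ler_piMr ?(ltW pn0) // invf_le1 ?exprn_gt0 ?ltr0n ?prime_gt0 //.
by rewrite exprn_ege1 // ler1n prime_gt0.
Qed.

Lemma LSig_box n x : x \in box n -> LSig R x <= 4 * p%:R ^+ n.
Proof.
by rewrite mem_box => /andP [/Lp_interval1 h1 /Lp_interval1 h2]; rewrite /LSig; lra.
Qed.

Lemma interval1_Lp n r : Lp R r <= p%:R ^+ n -> r \in interval1 n.
Proof.
move=> le.
have le1 : `|ratr (val r)| <= p%:R ^+ n :> R.
  by apply: le_trans le; rewrite lerDl padic_ge0.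
have le2 : padic_norm R p (val r) <= p%:R ^+ n.
  by apply: le_trans le; rewrite lerDr.
have kn : (kexp r <= n)%N.
  (* With a positive exponent the reduced numerator is prime to [p], so the p-adic norm is exactly
     p^(kexp r) and bounds the exponent. *)
  case: (posnP (kexp r)) => [-> //|k0].
  have r0 : val r != 0.
    by apply: contraTneq k0 => r0; rewrite /kexp r0 /= logn1.
  have q0 : qnum r != 0 by rewrite numq_eq0.
  have := le2; rewrite (padic_frac R p_pr q0 (Z1p_canon p_pr r)).
  have -> : logn p `|qnum r| = 0%N.
    apply/eqP; rewrite -leqn0 leqNgt logn_gt0 mem_primes p_pr absz_gt0 q0 /=.
    apply/negP => pq; have := coprime_num_den (val r).
    rewrite Z1p_denq // absz_nat coprime_pexpr // coprime_sym prime_coprime //.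
    by rewrite pq.
  rewrite divr1 -!natrX ler_nat leq_exp2l // prime_gt1 //.
have ra := Z1p_numer p_pr kn; apply/interval1P; eexists; first exact: ra.
set a := (_ * _) in ra *.
rewrite -(ler_int R) intr_norm -ratr_int -ra rmorphM /= rmorphXn /= ratr_int -pmulrn.
rewrite normrM [`|p%:R ^+ n|]ger0_norm ?exprn_ge0 // -pmulrn natrX exprD.
by rewrite ler_wpM2r // exprn_ge0.
Qed.

Lemma box_LSig n x : LSig R x <= p%:R ^+ n -> x \in box n.
Proof.
move=> le; rewrite mem_box !interval1_Lp //; apply: le_trans le.
  by rewrite lerDr Lp_ge0.
by rewrite lerDl Lp_ge0.
Qed.

End Boxes.

(** * Truncation of elements of bounded Lipschitz seminorm *)

Section Multipliers.
Variables (R : realType) (p : nat) (theta : nat -> R).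
Hypothesis p_pr : prime p.
Hypothesis thetaO : Omega p theta.
Implicit Types (x y z : Gam p) (a : Gam p -> R[i]) (c : R) (K : mat R p).

(** The matrix of the commutator of K with the diagonal operator [Dp]. *)
Definition comm K : mat R p := fun x y => creal (LSig R x - LSig R y) * K x y.

Lemma LDE a : LD theta a = opnorm (comm (lam theta a)).
Proof.
have e g : fin_supp g -> (fun x => Dp (mapp (lam theta a) g) x - mapp (lam theta a) (Dp g) x) =
    mapp (comm (lam theta a)) g.
  move=> /finsuppP [s us g0]; apply/funext => x; rewrite /Dp !(mappE _ _ us) //; last first.
    by move=> y /g0 ->; rewrite mulr0.
  rewrite mulr_sumr -sumrB; apply: eq_bigr => y _.
  by rewrite /comm crealB; ring.
congr ereal_sup; apply/seteqP; split => _ [g [fg g1] <-]; exists g => //.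
  by rewrite e.
by rewrite e.
Qed.

(** By the bicharacter property, shifting both indices by [g] changes the phase only by sigma(x - y,
    g), which splits into a factor in [x] and one in [y]. Translated blocks thus have the norm of a
    block at the origin. *)
Lemma lam_translate a g x y : lam theta a x y =
  sigma theta x g * lam theta a (x - g) (y - g) * conjc (sigma theta y g).
Proof.
have e : x - g - (y - g) = x - y by rewrite opprB addrA subrK.
rewrite /lam !gsubE e (sigmaDr p_pr thetaO _ y (- g)) (sigmaNr p_pr thetaO).
rewrite (sigmaDl p_pr thetaO x (- y) g) (sigmaNl p_pr thetaO) conjcM conjcK.
rewrite -[LHS]mul1r -[X in X * _ = _](sigmaM_conj theta x g) -[LHS]mulr1.
by rewrite -[X in _ * X = _](sigmaM_conj theta y g); ring.
Qed.

Lemma lam_multiplier a (m : Gam p -> R) x y :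
  lam theta (fun z => creal (m z) * a z) x y = creal (m (x - y)) * lam theta a x y.
Proof. by rewrite /lam gsubE mulrCA. Qed.

Lemma Bnd_lam a : CC a -> exists c, Bnd (lam theta a) c.
Proof.
move=> /finsuppP [s us a0]; exists (\sum_(z <- s) cabs (a z)); apply: Bnd_fin => //.
  by move=> z /a0 ->; rewrite cabs0.
by move=> x y; rewrite cabsM cabs_sigma mul1r.
Qed.

Lemma Bnd_comm_lam a : CC a -> exists c, Bnd (comm (lam theta a)) c.
Proof.
move=> /finsuppP [s us a0]; exists (\sum_(z <- s) LSig R z * cabs (a z)).
apply: Bnd_fin => //; first by move=> z /a0 ->; rewrite cabs0 mulr0.
move=> x y; rewrite !cabsM cabs_sigma mul1r cabs_creal ler_wpM2r ?cabs_ge0 //.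
exact: LSig_lip.
Qed.

(* Equal to [1] on [box (n + 2)] and to [0] outside [box (n + 4)]. *)
Definition cutoff n : Gam p -> R := avg R (fun w => w \in box p (n + 3)) (box p n).

(** The outer box [n + 7] keeps the set of rows finite, as the averaging estimate requires. *)
Definition shell n : Gam p -> R :=
  avg R (fun w => (w \notin box p (n + 3)) && (w \in box p (n + 7))) (box p n).

Lemma avg_all (P : pred (Gam p)) Y z : (0 < size Y)%N -> {in Y, forall h, P (h + z)} ->
  avg R P Y z = 1.
Proof.
move=> Y0 PY; rewrite /avg; have /eqP -> : count (fun h => P (h + z)) Y == size Y.
  by rewrite -all_count; apply/allP.
by rewrite divff // pnatr_eq0 -lt0n.
Qed.

Lemma cutoff_eq1 n z : z \in box p (n + 2) -> cutoff n z = 1.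
Proof.
move=> zn; apply: avg_all; first exact: size_box_gt0.
by move=> h hn; apply: boxD hn zn => //; lia.
Qed.

Lemma cutoff_eq0 n z : z \notin box p (n + 4) -> cutoff n z = 0.
Proof.
move=> zn; rewrite /cutoff /avg.
have -> : count (fun h => h + z \in box p (n + 3)) (box p n) = 0%N.
  apply/eqP; rewrite -leqn0 leqNgt -has_count; apply: contraNN zn => /hasP [h hn hz].
  rewrite -(addrK h z) addrC (addrC z); apply: boxD (boxN p_pr hn) hz => //; lia.
by rewrite mul0r.
Qed.

(** Translating [box n] by such a [z] stays inside [box (n + 7)], so the outer constraint is void
    and the complement is counted. *)
Lemma shellE n z : z \in box p (n + 6) -> shell n z = 1 - cutoff n z.
Proof.
move=> zn; rewrite /shell /cutoff /avg.
rewrite (@eq_in_count _ _ (predC (fun h => h + z \in box p (n + 3)))); last first.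
  move=> h hn /=; rewrite (_ : h + z \in box p (n + 7)) ?andbT //.
  by apply: boxD hn zn => //; lia.
have s0 : (size (box p n))%:R != 0 :> R by rewrite pnatr_eq0 -lt0n size_box_gt0.
rewrite -[X in X - _](divff s0) -mulrBl; congr (_ / _).
rewrite -(count_predC (fun h => h + z \in box p (n + 3))) natrD.
by rewrite addrC addKr.
Qed.

(** Three zones: on [box (n + 4)] the outer cutoff is 1; from there to [box (n + 6)] the inner
    cutoff is 0 and the shell is 1; beyond, both cutoffs vanish. So a difference of truncations is a
    shell multiplier followed by a cutoff. *)
Lemma cutoff_shell n z : cutoff (n + 2) z * shell n z = cutoff (n + 2) z - cutoff n z.
Proof.
have [z4|z4] := boolP (z \in box p (n + 4)).
  rewrite cutoff_eq1; last by rewrite -addnA.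
  by rewrite mul1r shellE //; apply: box_le z4 => //; lia.
rewrite (cutoff_eq0 z4) subr0; have [z6|z6] := boolP (z \in box p (n + 6)).
  by rewrite shellE // (cutoff_eq0 z4) subr0 mulr1.
by rewrite (@cutoff_eq0 (n + 2)) ?mul0r // -addnA.
Qed.

Lemma Bnd_cutoff K c n : Bnd K c ->
  Bnd (fun x y => creal (cutoff n (x - y)) * K x y) ((p ^ (4 * 3))%:R * c).
Proof.
move=> B; apply: (@Bnd_avg _ _ _ _ _ (box p (n + 3))) => //.
- exact: box_uniq.
- exact: box_uniq.
- by rewrite ler1n expn_gt0 prime_gt0.
- exact: size_box_ratio.
move=> g; exact: (Bnd_contract (fun x => x - g \in box p (n + 3))
  (fun y => y - g \in box p n) B).
Qed.

Lemma Bnd_shell a c n : CC a -> Bnd (comm (lam theta a)) c ->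
  Bnd (fun x y => creal (shell n (x - y)) * lam theta a x y)
      ((p ^ (4 * 7))%:R * (c / (4 * p%:R ^+ n))).
Proof.
move=> Ca B; apply: (@Bnd_avg _ _ _ _ _ (box p (n + 7))) => //.
- exact: box_uniq.
- exact: box_uniq.
- by move=> x /andP [].
- by rewrite ler1n expn_gt0 prime_gt0.
- exact: size_box_ratio.
move=> g; have [M BM] := Bnd_lam Ca.
pose P x := (x \notin box p (n + 3)) && (x \in box p (n + 7)).
have r0 : 0 < 4 * p%:R ^+ n :> R by rewrite mulr_gt0 // exprn_gt0 // ltr0n prime_gt0.
have lP x : P x -> 2 * (4 * p%:R ^+ n) <= LSig R x.
  move=> /andP [xn _]; apply: (@le_trans _ _ (p%:R ^+ (n + 3))).
    (* Here the gap of three levels is used: p^3 >= 8 makes rows at least twice as long as the bound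
       4 p^n on columns. *)
    have p8 : 2 ^+ 3 <= p%:R ^+ 3 :> R by rewrite lerXn2r ?nnegrE // ler_nat prime_gt1.
    have pn0 : 0 <= p%:R ^+ n :> R by rewrite exprn_ge0.
    by rewrite exprD; have := ler_wpM2l pn0 p8; lra.
  by rewrite leNgt; apply: contraNN xn => /ltW /box_LSig; exact.
have lQ y : y \in box p n -> 0 <= LSig R y <= 4 * p%:R ^+ n.
  by move=> yn; rewrite LSig_ge0 //= LSig_box.
have B1 := Bnd_translate g (Bnd_block r0 lP lQ B BM).
have sle x : cabs (sigma theta x g) <= 1 by rewrite cabs_sigma.
have sle' x : cabs (conjc (sigma theta x g)) <= 1 by rewrite cabs_conj cabs_sigma.
apply: eq_Bnd (Bnd_diag sle sle' B1) => x y; rewrite -/(P _).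
by case: ifP => _; rewrite ?mulr0 ?mul0r // -lam_translate.
Qed.

(** The exponent 40 = 12 + 28 collects the box ratios of [Bnd_cutoff] and [Bnd_shell]; the factor 2
    pays for the geometric series. *)
Definition tail_const n : R := 2 * (p ^ 40)%:R / p%:R ^+ n.

Lemma tail_const_ge0 n : 0 <= tail_const n.
Proof. by rewrite divr_ge0 ?exprn_ge0 ?mulr_ge0. Qed.

Lemma Bnd_step a c n : CC a -> Bnd (comm (lam theta a)) c ->
  Bnd (fun x y => creal (cutoff (n + 2) (x - y) - cutoff n (x - y)) * lam theta a x y)
      (tail_const n / 2 * c).
Proof.
move=> Ca B; have c0 := Bnd_ge0 B.
have pn0 : 0 < p%:R ^+ n :> R by rewrite exprn_gt0 // ltr0n prime_gt0.
have := Bnd_cutoff (n + 2) (Bnd_shell n Ca B).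
set b := (_ * _ : R) => Bb; apply: (@Bnd_le _ _ _ b).
  rewrite /b /tail_const mulrA -natrM -expnD.
  have -> : 2 * (p ^ 40)%:R / p%:R ^+ n / 2 * c = (p ^ 40)%:R * (c / p%:R ^+ n) :> R.
    by field; rewrite gt_eqF.
  rewrite ler_wpM2l // ler_wpM2l // lef_pV2 ?posrE //; last by rewrite mulr_gt0.
  lra.
apply: eq_Bnd Bb => x y; rewrite -cutoff_shell crealM mulrA //.
Qed.

Lemma tail_const_half n : tail_const n / 2 + tail_const (n + 2) <= tail_const n.
Proof.
have p2 : 2 <= p%:R :> R by rewrite ler_nat prime_gt1.
have pn0 : 0 < p%:R ^+ n :> R by rewrite exprn_gt0 // ltr0n prime_gt0.
have -> : tail_const (n + 2) = tail_const n / p%:R ^+ 2.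
  by rewrite /tail_const exprD; field; rewrite !gt_eqF // ltr0n prime_gt0.
have le : tail_const n / p%:R ^+ 2 <= tail_const n / 2.
  rewrite ler_wpM2l ?tail_const_ge0 // lef_pV2 ?posrE ?exprn_gt0 //; last by lra.
  rewrite expr2; nra.
lra.
Qed.

(** Steps of two levels have bounds decreasing by p^-2 <= 1/2, so [tail_const_half] closes the
    induction with a constant independent of [k]. *)
Lemma Bnd_telescope a c n k : CC a -> Bnd (comm (lam theta a)) c ->
  Bnd (fun x y => creal (cutoff (n + k.*2) (x - y) - cutoff n (x - y)) * lam theta a x y)
      (tail_const n * c).
Proof.
move=> Ca B; have c0 := Bnd_ge0 B; elim: k n => [|k ih] n.
  apply: (@Bnd_le _ _ _ 0); first by rewrite mulr_ge0 ?tail_const_ge0.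
  apply: eq_Bnd (@Bnd0 R p) => x y.
  by rewrite addn0 subrr creal0 mul0r.
apply: (@Bnd_le _ _ _ (tail_const n / 2 * c + tail_const (n + 2) * c)).
  by rewrite -mulrDl ler_wpM2r // tail_const_half.
apply: eq_Bnd (BndD (Bnd_step n Ca B) (ih (n + 2)%N)) => x y.
rewrite -mulrDl -crealD doubleS; congr (creal _ * _).
have -> : (n + k.*2.+2 = n + 2 + k.*2)%N by lia.
by rewrite addrC subrKA.
Qed.

Lemma box_exhaust (s : seq (Gam p)) : exists N, {subset s <= box p N}.
Proof.
elim: s => [|x s [N sN]]; first by exists 0%N.
have [M xM] : exists M, x \in box p M.
  exists (Num.Def.archi_bound (LSig R x)); apply: (@box_LSig R) => //.
  apply: ltW; apply: lt_le_trans (archi_boundP (LSig_ge0 R x)) _ => //.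
  by rewrite -natrX ler_nat ltnW // ltn_expl // prime_gt1.
exists (maxn M N) => y; rewrite inE => /orP [/eqP ->|/sN].
  exact: (box_le p_pr (leq_maxl M N)).
exact: (box_le p_pr (leq_maxr M N)).
Qed.

(** The finite support lies in some box, on which a far enough cutoff is identically 1; the tail is
    thus a finite telescope. *)
Lemma Bnd_tail a c n : CC a -> Bnd (comm (lam theta a)) c ->
  Bnd (lam theta (fun z => creal (1 - cutoff n z) * a z)) (tail_const n * c).
Proof.
move=> Ca B; have [s us a0] := finsuppP Ca; have [N sN] := box_exhaust s.
apply: eq_Bnd (Bnd_telescope n N Ca B) => x y; rewrite lam_multiplier.
have [xs|/a0 axy] := boolP (x - y \in s); last by rewrite /lam gsubE axy !mulr0.
rewrite (@cutoff_eq1 (n + N.*2)) //; apply: (box_le p_pr) (sN _ xs); lia.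
Qed.

End Multipliers.

(** * Adjoints, twisted convolution and the Leibniz inequality *)

Section Algebra.
Variables (R : realType) (p : nat) (theta : nat -> R).
Hypothesis p_pr : prime p.
Hypothesis thetaO : Omega p theta.
Implicit Types (x y z : Gam p) (a b f : Gam p -> R[i]) (c : R) (K : mat R p).

Lemma CC_lin f g (w : R[i]) : CC f -> CC g -> CC (fun x : Gam p => f x + w * g x).
Proof.
move=> /finsuppP [s _ f0] /finsuppP [t _ g0]; apply: (@finsupp_seq _ _ (s ++ t)) => x.
by rewrite mem_cat negb_or => /andP [/f0 -> /g0 ->]; rewrite mulr0 addr0.
Qed.

Lemma lam_lin f g (w : R[i]) x y :
  lam theta (fun z => f z + w * g z) x y = lam theta f x y + w * lam theta g x y.
Proof. by rewrite /lam mulrDr mulrCA. Qed.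

Lemma lamZ f (w : R[i]) x y :
  lam theta (fun z => w * f z) x y = w * lam theta f x y.
Proof. by rewrite /lam mulrCA. Qed.

(** The column at the unit lists the coefficients, so bounds on entries become bounds on
    coefficients. *)
Lemma lam0 f x : lam theta f x 0 = f x.
Proof. by rewrite /lam gsubE subr0 (sigma0r p_pr thetaO) mul1r. Qed.

(** The involution of the twisted algebra, with the conjugate of sigma(z, -z) written as sigma(z,
    z). *)
Definition adjf f : Gam p -> R[i] := fun z => sigma theta z z * conjc (f (- z)).

Lemma CC_adjf f : CC f -> CC (adjf f).
Proof.
move=> /finsuppP [s _ f0]; apply: (@finsupp_seq _ _ [seq - x | x <- s]) => x xs.
rewrite /adjf f0 ?conjc0 ?mulr0 //; apply: contraNN xs => xs.
by apply/mapP; exists (- x); rewrite ?opprK.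
Qed.

Lemma lam_adjf f x y : lam theta (adjf f) x y = conjc (lam theta f y x).
Proof.
rewrite /lam /adjf !gsubE opprB conjcM -(sigmaNl p_pr thetaO) opprB mulrA; congr (_ * _).
by rewrite -(sigmaDr p_pr thetaO) [y + _]addrC subrK.
Qed.

Lemma lam_delta0 : lam theta (fun z => (z == 0)%:R) = idm.
Proof.
apply/funext => x; apply/funext => y; rewrite /lam /idm gsubE subr_eq0.
by case: eqP => [->|_]; rewrite ?mulr0 // subrr (sigma0l p_pr thetaO) mulr1.
Qed.

Lemma CC_delta z : CC (fun x : Gam p => (x == z)%:R : R[i]).
Proof. by apply: (@finsupp_seq _ _ [:: z]) => x; rewrite inE => /negbTE ->. Qed.

Lemma lam_col f (s : seq (Gam p)) : CC f -> exists2 t : seq (Gam p), uniq t &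
  forall z y, y \in s -> z \notin t -> lam theta f z y = 0.
Proof.
move=> /finsuppP [r _ f0]; exists (undup [seq x + y | x <- r, y <- s]).
  exact: undup_uniq.
move=> z y ys; rewrite mem_undup => zt; rewrite /lam gsubE f0 ?mulr0 //.
apply: contraNN zt => zr; apply/allpairsP; exists (z - y, y); split=> //=.
by rewrite subrK.
Qed.

(** Multiplicativity of the representation: after the substitution z = x - h the phases agree by the
    bicharacter property. Finiteness is asked of the products only, so either factor may supply
    it. *)
Lemma lam_tconv f g (t : seq (Gam p)) x y : uniq t ->
  (forall z, z \notin t -> lam theta f x z * lam theta g z y = 0) ->
  lam theta (tconv theta f g) x y = \sum_(z <- t) lam theta f x z * lam theta g z y.
Proof.
move=> ut g0; rewrite {1}/lam gsubE /tconv.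
have term h : sigma theta (x - y) y *
   (f h * g (gsub (x - y) h) * sigma theta h (gsub (x - y) h)) =
   lam theta f x (x - h) * lam theta g (x - h) y.
  rewrite /lam !gsubE subKr [x - h - y]addrAC.
  rewrite (_ : sigma theta (x - y - h) y = sigma theta (x - y) y * conjc (sigma theta h y)).
    rewrite (_ : sigma theta h (x - y - h) = sigma theta h (x - h) * conjc (sigma theta h y)).
      by ring.
    by rewrite -(sigmaNr p_pr thetaO) -(sigmaDr p_pr thetaO) addrAC.
  by rewrite -(sigmaNl p_pr thetaO) -(sigmaDl p_pr thetaO).
rewrite (@fsumE _ _ _ [seq x - z | z <- t]).
- rewrite mulr_sumr big_map; apply: eq_bigr => z _.
  by rewrite term subKr.
- by rewrite map_inj_uniq // => u v /addrI /oppr_inj.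
move=> h ht; apply: (mulfI (sigma_neq0 theta (x - y) y)); rewrite term mulr0 g0 //.
by apply: contraNN ht => xt; apply/mapP; exists (x - h); rewrite ?subKr.
Qed.

Lemma CC_tconv f g : CC f -> CC g -> CC (tconv theta f g).
Proof.
move=> /finsuppP [s _ f0] /finsuppP [t _ g0].
apply: (@finsupp_seq _ _ [seq x + y | x <- s, y <- t]) => z zst.
rewrite /tconv (@fsumE _ _ _ [::]) ?big_nil // => h _.
have [hs|/f0 ->] := boolP (h \in s); last by rewrite !mul0r.
rewrite g0 ?mulr0 ?mul0r //; apply: contraNN zst => zt.
by apply/allpairsP; exists (h, gsub z h); split=> //=; rewrite gsubE addrC subrK.
Qed.

(** Meant for [K2] equal to [lam theta g] or its commutator, whose columns inherit finite support
    from [g]. *)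
Lemma Bnd_lam_prod f g K1 K2 c1 c2 : CC g -> Bnd K1 c1 -> Bnd K2 c2 ->
  (forall z y, lam theta g z y = 0 -> K2 z y = 0) ->
  Bnd (fun x y => \sum_(z \in [set: Gam p]) K1 x z * K2 z y) (c1 * c2).
Proof.
move=> Cg B1 B2 K20; apply: (Bnd_comp B1 B2) => s.
have [t ut t0] := lam_col s Cg; exists t => // x y ys.
by apply: fsumE => // z zt; rewrite K20 ?mulr0 // t0.
Qed.

(* The derivation property [[D, AB] = [D, A] B + A [D, B]]. *)
Lemma Bnd_comm_tconv f g cf nf cg ng : CC g ->
  Bnd (comm (lam theta f)) cf -> Bnd (lam theta f) nf ->
  Bnd (comm (lam theta g)) cg -> Bnd (lam theta g) ng ->
  Bnd (comm (lam theta (tconv theta f g))) (cf * ng + nf * cg).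
Proof.
move=> Cg Bcf Bf Bcg Bg.
have c0 z y : lam theta g z y = 0 -> comm (lam theta g) z y = 0 by rewrite /comm => ->; rewrite mulr0.
apply: eq_Bnd (BndD (Bnd_lam_prod f Cg Bcf Bg (fun _ _ => id)) (Bnd_lam_prod f Cg Bf Bcg c0)) => x y.
have [t ut t0] := lam_col [:: y] Cg; have {}t0 z : z \notin t -> lam theta g z y = 0.
  by apply: t0; rewrite mem_head.
rewrite !(@fsumE _ _ _ t) //; first last.
- by move=> z /t0 g0; rewrite g0 mulr0.
- by move=> z /t0 g0; rewrite c0 ?mulr0.
rewrite {3}/comm (@lam_tconv _ _ t) //; last by move=> z /t0 ->; rewrite mulr0.
rewrite -big_split mulr_sumr; apply: eq_bigr => z _ /=; rewrite /comm !crealB.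
by ring.
Qed.

Lemma tconv_adj f g x y : CC f -> selfadj_mat (lam theta f) -> selfadj_mat (lam theta g) ->
  conjc (lam theta (tconv theta f g) y x) = lam theta (tconv theta g f) x y.
Proof.
move=> Cf sf sg; have [t ut t0] := lam_col [:: y] Cf.
have {}t0 z : z \notin t -> lam theta f z y = 0 by apply: t0; rewrite mem_head.
rewrite !(@lam_tconv _ _ t) //; first last.
- by move=> z /t0 fz; rewrite sf fz conjc0 mul0r.
- by move=> z /t0 ->; rewrite mulr0.
rewrite conjc_sum; apply: eq_bigr => z _.
by rewrite conjcM -sf -sg mulrC.
Qed.

Lemma lam_jordan f g x y : lam theta (jordan theta f g) x y =
  2^-1 * (lam theta (tconv theta f g) x y + lam theta (tconv theta g f) x y).
Proof. by rewrite /lam /jordan; ring. Qed.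

Lemma lam_lie f g x y : lam theta (lie theta f g) x y =
  (2 * 'i%C)^-1 * (lam theta (tconv theta f g) x y - lam theta (tconv theta g f) x y).
Proof. by rewrite /lam /lie; ring. Qed.

Lemma conj_2i : conjc ((2 * 'i%C)^-1 : R[i]) = - (2 * 'i%C)^-1.
Proof.
have ci : conjc 'i%C = - 'i%C :> R[i] by apply/eqP; rewrite eq_complex /= oppr0 !eqxx.
by rewrite conjc_inv conjcM conjc_nat ci mulrN invrN.
Qed.

Lemma cabs_half : cabs (2^-1 : R[i]) = 2^-1.
Proof.
have -> : 2^-1 = creal 2^-1 :> R[i] by rewrite crealV /creal rmorph_nat.
by rewrite cabs_creal ger0_norm ?invr_ge0.
Qed.

Lemma cabs_i : cabs ('i%C : R[i]) = 1.
Proof. by rewrite /cabs /= expr0n expr1n add0r sqrtr1. Qed.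

Lemma cabs_2i : cabs ((2 * 'i%C)^-1 : R[i]) = 2^-1.
Proof.
have i0 : 'i%C != 0 :> R[i] by rewrite -cabs_eq0 cabs_i oner_eq0.
rewrite invfM cabsM cabs_half.
have -> : cabs (('i%C : R[i])^-1) = 1; last by rewrite mulr1.
by apply: (mulfI (oner_neq0 R)); rewrite -{1}cabs_i -cabsM divff // cabs1 mulr1.
Qed.

Lemma domL_jordan a b : domL theta a -> domL theta b -> domL theta (jordan theta a b).
Proof.
move=> [Ca sa] [Cb sb]; split.
  have -> : jordan theta a b = (fun x => 0 + 2^-1 * (tconv theta a b x + 1 * tconv theta b a x)).
    by apply/funext => x; rewrite /jordan; ring.
  apply: CC_lin; first by apply: (@finsupp_seq _ _ [::]).
  by apply: CC_lin; apply: CC_tconv.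
move=> x y; rewrite !lam_jordan conjcM conjcD !tconv_adj // conjc_inv conjc_nat.
by rewrite [X in _ * X]addrC.
Qed.

Lemma domL_lie a b : domL theta a -> domL theta b -> domL theta (lie theta a b).
Proof.
move=> [Ca sa] [Cb sb]; split.
  have -> : lie theta a b =
      (fun x => 0 + (2 * 'i%C)^-1 * (tconv theta a b x + (-1) * tconv theta b a x)).
    by apply/funext => x; rewrite /lie; ring.
  apply: CC_lin; first by apply: (@finsupp_seq _ _ [::]).
  by apply: CC_lin; apply: CC_tconv.
move=> x y; rewrite !lam_lie conjcM conjcB !tconv_adj // conj_2i.
by rewrite mulNr -mulrN opprB.
Qed.

Lemma Bnd_comm_lin f g (w : R[i]) cf cg :
  Bnd (comm (lam theta f)) cf -> Bnd (comm (lam theta g)) cg ->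
  Bnd (comm (lam theta (fun x => f x + w * g x))) (cf + cabs w * cg).
Proof.
move=> Bf Bg; apply: eq_Bnd (BndD Bf (BndZ w Bg)) => x y.
by rewrite /comm lam_lin; ring.
Qed.

Lemma Bnd_comm_Z f (w : R[i]) c :
  Bnd (comm (lam theta f)) c -> Bnd (comm (lam theta (fun x => w * f x))) (cabs w * c).
Proof. by move=> B; apply: eq_Bnd (BndZ w B) => x y; rewrite /comm lamZ mulrCA. Qed.

Lemma LD_fin a : CC a -> exists2 c, LD theta a = c%:E & Bnd (comm (lam theta a)) c.
Proof. by move=> /(Bnd_comm_lam theta p_pr) [c /Bnd_opnorm]; rewrite -LDE. Qed.

Lemma LD_leP a c : (LD theta a <= c%:E)%E <-> Bnd (comm (lam theta a)) c.
Proof. by rewrite LDE; exact: opnormP. Qed.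

Lemma opnorm_lam_fin a : CC a -> exists2 c, opnorm (lam theta a) = c%:E & Bnd (lam theta a) c.
Proof. by move=> /(Bnd_lam theta) [c /Bnd_opnorm]. Qed.

Lemma domL_lin a b (t : R) : domL theta a -> domL theta b ->
  domL theta (fun x => a x + creal t * b x).
Proof.
move=> [Ca sa] [Cb sb]; split; first exact: CC_lin.
by move=> x y; rewrite !lam_lin conjcD (conjcM (creal t)) conjc_creal -sa -sb.
Qed.

Lemma LDD a b : CC a -> CC b ->
  (LD theta (fun x : Gam p => (a x + b x)%R) <= LD theta a + LD theta b)%E.
Proof.
move=> /LD_fin [ca -> Ba] /LD_fin [cb -> Bb]; rewrite -EFinD; apply/LD_leP.
have := Bnd_comm_lin 1 Ba Bb; rewrite cabs1 mul1r.
by apply: eq_Bnd => x y; rewrite /comm /lam mul1r.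
Qed.

Lemma LDZ a (t : R) : CC a ->
  LD theta (fun x : Gam p => (creal t * a x)%R) = (`|t|%:E * LD theta a)%E.
Proof.
move=> Ca; have Cta : CC (fun x => creal t * a x).
  have := CC_lin (creal t) (@finsupp_seq R p [::] (fun=> 0) (fun _ _ => erefl)) Ca.
  by congr CC; apply/funext => x; rewrite add0r.
have [c Ec Bc] := LD_fin Ca; have [b Eb Bb] := LD_fin Cta.
rewrite Ec Eb -EFinM; congr _%:E; apply/eqP; rewrite eq_le; apply/andP; split.
  rewrite -lee_fin -Eb; apply/LD_leP; rewrite -cabs_creal; exact: Bnd_comm_Z.
have [->|t0] := eqVneq t 0; first by rewrite normr0 mul0r (Bnd_ge0 Bb).
rewrite mulrC -ler_pdivlMr ?normr_gt0 // mulrC -lee_fin -Ec; apply/LD_leP.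
have := Bnd_comm_Z (creal t^-1) Bb; rewrite cabs_creal normfV.
apply: eq_Bnd => x y; rewrite /comm /lam [creal _ * (creal t * _)]mulrA -crealM mulVf //.
by rewrite creal1 mul1r.
Qed.

(** The column at 0 of the commutator has entries of modulus LSig x |a x|; if they vanish, [a] lives
    at 0, and self-adjointness makes its value real. *)
Lemma LD_eq0P a : domL theta a ->
  LD theta a = 0%E <-> exists t : R, lam theta a = (fun x y => creal t * idm x y).
Proof.
move=> [Ca sa]; split=> [L0|[t at_]]; last first.
  apply/eqP; rewrite eq_le {2}LDE opnorm_ge0 andbT; apply/LD_leP.
  apply: eq_Bnd (@Bnd0 R p) => x y; rewrite /comm at_ /idm.
  by case: eqP => [->|_]; rewrite ?subrr ?creal0 ?mul0r ?mulr0.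
have B : Bnd (comm (lam theta a)) 0 by apply/LD_leP; rewrite L0.
have a0 x : x != 0 -> a x = 0.
  move=> x0; have := Bnd_entry x 0 B; rewrite /comm lam0 (LSig0 R p) subr0 cabsM cabs_creal.
  rewrite gtr0_norm ?LSig_gt0 // pmulr_rle0 ?LSig_gt0 // => le.
  by apply/eqP; rewrite -cabs_eq0 eq_le le cabs_ge0.
exists (complex.Re (a 0)); apply/funext => x; apply/funext => y.
have ca : a 0 = creal (complex.Re (a 0)).
  have := sa 0 0; rewrite lam0; case: (a 0) => u v [] /eqP.
  by rewrite -addr_eq0 -mulr2n mulrn_eq0 /= => /eqP ->.
rewrite -ca /lam gsubE /idm; have [->|xy] := eqVneq x y.
  by rewrite subrr (sigma0l p_pr thetaO) mul1r mulr1.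
by rewrite a0 ?subr_eq0 // !mulr0.
Qed.

(** Both orders of the product satisfy the same derivation bound, and the factor of modulus 1/2
    averages the two. *)
Lemma LD_leibniz a b : domL theta a -> domL theta b ->
  (LD theta (jordan theta a b) <=
     LD theta a * opnorm (lam theta b) + opnorm (lam theta a) * LD theta b)%E /\
  (LD theta (lie theta a b) <=
     LD theta a * opnorm (lam theta b) + opnorm (lam theta a) * LD theta b)%E.
Proof.
move=> [Ca sa] [Cb sb].
have [la Ela Ba] := LD_fin Ca; have [lb Elb Bb] := LD_fin Cb.
have [na Ena Na] := opnorm_lam_fin Ca; have [nb Enb Nb] := opnorm_lam_fin Cb.
have Bab := Bnd_comm_tconv Cb Ba Na Bb Nb; have Bba := Bnd_comm_tconv Ca Bb Nb Ba Na.
rewrite Ela Elb Ena Enb -!EFinM -EFinD; split; apply/LD_leP.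
  have := BndZ 2^-1 (BndD Bab Bba); rewrite cabs_half.
  have -> : 2^-1 * (la * nb + na * lb + (lb * na + nb * la)) = la * nb + na * lb by field.
  by apply: eq_Bnd => x y; rewrite /comm lam_jordan; ring.
have := BndZ (2 * 'i%C)^-1 (BndB Bab Bba); rewrite cabs_2i.
have -> : 2^-1 * (la * nb + na * lb + (lb * na + nb * la)) = la * nb + na * lb by field.
by apply: eq_Bnd => x y; rewrite /comm lam_lie; ring.
Qed.

(** A finite form nearly attaining the seminorm involves finitely many entries, each continuous for
    the operator norm. *)
Lemma LD_lsc a : domL theta a -> forall e : R, 0 < e ->
  exists2 d : R, 0 < d & forall b, domL theta b ->
    (opnorm (msub (lam theta a) (lam theta b)) < d%:E)%E ->
    (LD theta a - e%:E < LD theta b)%E.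
Proof.
move=> [Ca _] e e0; have [c Ec Bc] := LD_fin Ca.
(* Failure of the bound [c - e / 2] supplies the finite test vectors; the other half of [e] is left
   for the perturbation. *)
have nB : ~ Bnd (comm (lam theta a)) (c - e / 2).
  by move=> /LD_leP; rewrite Ec lee_fin; lra.
move/existsNP: nB => [s /existsNP [u /existsNP [v /not_implyP [us /negP]]]].
rewrite -ltNge; set q := (sqsum s u + _) / 2 => lt.
have q0 : 0 < q.
  have q_ge0 : 0 <= q by rewrite divr_ge0 // addr_ge0 // sqsum_ge0.
  rewrite lt_def q_ge0 andbT.
  apply: contraTneq lt => qe; rewrite -leNgt qe mulr0.
  by have := Bc s u v us; rewrite -/q qe mulr0.
pose S := \sum_(x <- s) \sum_(y <- s) cabs (u x) * `|LSig R x - LSig R y| * cabs (v y).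
have S0 : 0 <= S.
  by do 2 (apply: sumr_ge0 => ? _); rewrite !mulr_ge0 ?cabs_ge0.
have S1 : 0 < S + 1 by lra.
(* An entrywise change below this size moves the tested form by at most [e / 2 * q], as [S] sums the
   absolute coefficients. *)
exists (e / 2 * q / (S + 1)); first by rewrite divr_gt0 // mulr_gt0 // divr_gt0.
set d := _ / (S + 1) => b [Cb _] /opnorm_ltP [d' Bd ltd].
have [c' Ec' Bc'] := LD_fin Cb; rewrite Ec Ec' -EFinB lte_fin ltNge; apply/negP => lec.
have : cabs (form s u (comm (msub (lam theta a) (lam theta b))) v) <= d * S.
  rewrite mulr_sumr; apply: le_trans (cabs_sum _ _) _; apply: ler_sum => x _.
  rewrite mulr_sumr; apply: le_trans (cabs_sum _ _) _; apply: ler_sum => y _.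
  rewrite /comm !cabsM cabs_creal; have := Bnd_entry x y Bd => le.
  rewrite mulrA [leLHS]mulrAC [leLHS]mulrC.
  apply: ler_pM; rewrite ?mulr_ge0 ?cabs_ge0 //.
  exact: le_trans le (ltW ltd).
have -> : form s u (comm (msub (lam theta a) (lam theta b))) v =
   form s u (comm (lam theta a)) v - form s u (comm (lam theta b)) v.
  rewrite -[X in _ = _ + X]mulN1r -formZ -formD; apply: eq_form => // x y _ _.
  by rewrite /comm /msub; ring.
set A := form _ _ _ _ in lt *; set B := form _ _ _ _ => le.
have leB : cabs B <= c' * q by exact: Bc'.
have leA : cabs A <= cabs (A - B) + cabs B by rewrite -{1}(subrK B A) cabsD.
have dS : d * S <= e / 2 * q.
  by rewrite /d mulrAC ler_pdivrMr // ler_wpM2l //; [rewrite mulr_ge0 ?(ltW q0) // divr_ge0 // ltW|lra].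
have : c' * q <= (c - e) * q by rewrite ler_wpM2r // ltW.
move: lt; rewrite mulrBl [(c - e) * q]mulrBl; lra.
Qed.

End Algebra.

(** * States and the Monge-Kantorovich metric *)

Section States.
Variables (R : realType) (p : nat) (theta : nat -> R).
Hypothesis p_pr : prime p.
Hypothesis thetaO : Omega p theta.
Implicit Types (x y z : Gam p) (a b f : Gam p -> R[i]) (c e : R) (K H : mat R p).
Implicit Types (phi psi : mat R p -> R[i]).

Definition delta x : Gam p -> R[i] := fun z => (z == x)%:R.

Definition re_mx K : mat R p := fun x y => 2^-1 * (K x y + conjc (K y x)).

Definition im_mx K : mat R p := fun x y => (2 * 'i%C)^-1 * (K x y - conjc (K y x)).

Lemma re_im_mx K x y : re_mx K x y + 'i%C * im_mx K x y = K x y.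
Proof.
have i0 : 'i%C != 0 :> R[i] by rewrite -cabs_eq0 cabs_i oner_eq0.
by rewrite /re_mx /im_mx; field.
Qed.

Lemma re_mx_sa K : selfadj_mat (re_mx K).
Proof.
move=> x y; rewrite /re_mx (conjcM 2^-1) conjcD conjcK conjc_inv conjc_nat.
by rewrite [X in _ = _ * X]addrC.
Qed.

Lemma im_mx_sa K : selfadj_mat (im_mx K).
Proof.
move=> x y; rewrite /im_mx (conjcM (2 * 'i%C)^-1) conjcB conjcK conj_2i.
by rewrite mulNr -mulrN opprB.
Qed.

Lemma Bnd_re K c : Bnd K c -> Bnd (re_mx K) c.
Proof.
move=> B; have := BndZ 2^-1 (BndD B (Bnd_adj B)); rewrite cabs_half.
by have -> : 2^-1 * (c + c) = c by field.
Qed.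

Lemma Bnd_im K c : Bnd K c -> Bnd (im_mx K) c.
Proof.
move=> B; have := BndZ (2 * 'i%C)^-1 (BndB B (Bnd_adj B)); rewrite cabs_2i.
by have -> : 2^-1 * (c + c) = c by field.
Qed.

Lemma inAP K : inA theta K <->
  forall e, 0 < e -> exists f, CC f /\ Bnd (fun x y => K x y - lam theta f x y) e.
Proof.
split=> AK e e0.
  have [f [Cf /opnorm_ltP [b B lt]]] := AK e e0.
  by exists f; split=> //; apply: Bnd_le B; exact: ltW.
have e20 : 0 < e / 2 by lra.
have [f [Cf B]] := AK _ e20; exists f; split=> //.
by apply/opnorm_ltP; exists (e / 2) => //; lra.
Qed.

Lemma inA_lam f : CC f -> inA theta (lam theta f).
Proof.
move=> Cf; apply/inAP => e e0; exists f; split=> //; apply: (@Bnd_le _ _ _ 0); first exact: ltW.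
by apply: eq_Bnd (@Bnd0 R p) => x y; rewrite subrr.
Qed.

Lemma inA_id : inA theta (@idm R p).
Proof. by rewrite -(lam_delta0 p_pr thetaO); apply: inA_lam; exact: CC_delta. Qed.

Lemma inA_lin K H (w : R[i]) : inA theta K -> inA theta H ->
  inA theta (fun x y => K x y + w * H x y).
Proof.
move=> /inAP AK /inAP AH; apply/inAP => e e0.
have w1 : 0 < cabs w + 1 by have := cabs_ge0 w; lra.
have [f [Cf Bf]] := AK (e / 2) (divr_gt0 e0 (ltr0Sn _ 1)).
have [g [Cg Bg]] := AH (e / 2 / (cabs w + 1)) (divr_gt0 (divr_gt0 e0 (ltr0Sn _ 1)) w1).
exists (fun x => f x + w * g x); split; first exact: CC_lin.
apply: (@Bnd_le _ _ _ (e / 2 + cabs w * (e / 2 / (cabs w + 1)))).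
  have : cabs w * (e / 2 / (cabs w + 1)) <= e / 2.
    rewrite mulrA ler_pdivrMr // mulrC ler_wpM2l //; lra.
  by lra.
by apply: eq_Bnd (BndD Bf (BndZ w Bg)) => x y; rewrite lam_lin; ring.
Qed.

Lemma inAZ K (w : R[i]) : inA theta K -> inA theta (fun x y => w * K x y).
Proof.
move=> AK; have := inA_lin (w - 1) AK AK; congr (inA _).
by apply/funext => x; apply/funext => y; ring.
Qed.

Lemma inA_adj K : inA theta K -> inA theta (fun x y => conjc (K y x)).
Proof.
move=> /inAP AK; apply/inAP => e /AK [f [Cf B]]; exists (adjf theta f).
split; first exact: CC_adjf.
by apply: eq_Bnd (Bnd_adj B) => x y; rewrite lam_adjf // conjcB.
Qed.

Lemma inA_re K : inA theta K -> inA theta (re_mx K).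
Proof.
move=> AK; have := inAZ 2^-1 (inA_lin 1 AK (inA_adj AK)); congr (inA _).
by apply/funext => x; apply/funext => y; rewrite mul1r.
Qed.

Lemma inA_im K : inA theta K -> inA theta (im_mx K).
Proof.
move=> AK; have := inAZ (2 * 'i%C)^-1 (inA_lin (-1) AK (inA_adj AK)); congr (inA _).
by apply/funext => x; apply/funext => y; rewrite mulN1r.
Qed.

Definition re_fun f : Gam p -> R[i] := fun x => 2^-1 * (f x + adjf theta f x).

Definition im_fun f : Gam p -> R[i] := fun x => (2 * 'i%C)^-1 * (f x - adjf theta f x).

Lemma lam_re f : lam theta (re_fun f) = re_mx (lam theta f).
Proof.
apply/funext => x; apply/funext => y; rewrite lamZ /re_mx -(lam_adjf p_pr thetaO).
by rewrite /lam mulrDr.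
Qed.

Lemma lam_im f : lam theta (im_fun f) = im_mx (lam theta f).
Proof.
apply/funext => x; apply/funext => y; rewrite lamZ /im_mx -(lam_adjf p_pr thetaO).
by rewrite /lam mulrBr.
Qed.

Lemma CCZ f (w : R[i]) : CC f -> CC (fun x => w * f x).
Proof.
move=> Cf; have := CC_lin (w - 1) Cf Cf; congr CC.
by apply/funext => x; ring.
Qed.

Lemma domL_re f : CC f -> domL theta (re_fun f).
Proof.
move=> Cf; split; last by rewrite lam_re; exact: re_mx_sa.
apply: CCZ; have := CC_lin 1 Cf (CC_adjf theta Cf); congr CC.
by apply/funext => x; rewrite mul1r.
Qed.

Lemma domL_im f : CC f -> domL theta (im_fun f).
Proof.
move=> Cf; split; last by rewrite lam_im; exact: im_mx_sa.
apply: CCZ; have := CC_lin (-1) Cf (CC_adjf theta Cf); congr CC.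
by apply/funext => x; rewrite mulN1r.
Qed.

Lemma domL_dense K : inA theta K -> selfadj_mat K -> forall e, 0 < e ->
  exists a, domL theta a /\ (opnorm (msub K (lam theta a)) < e%:E)%E.
Proof.
move=> AK sK e e0; have [f [Cf /opnorm_ltP [b B lt]]] := AK e e0.
exists (re_fun f); split; first exact: domL_re.
apply/opnorm_ltP; exists b => //; apply: eq_Bnd (Bnd_re B) => x y.
by rewrite lam_re /re_mx /msub conjcB -sK; field.
Qed.

(** For self-adjoint [K] the quadratic form is real, and the bound makes it at least -c |g|^2. *)
Lemma pos_op_shift K c : selfadj_mat K -> Bnd K c ->
  pos_op (fun x y => K x y + creal c * idm x y).
Proof.
move=> sK B g /finsuppP [s us g0].
rewrite (@fsumE _ _ _ s) //; last by move=> x /g0 ->; rewrite conjc0 mulr0.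
have -> : \sum_(x <- s) mapp (fun x y => K x y + creal c * idm x y) g x * conjc (g x) =
    form s (conjc \o g) K g + creal (c * sqsum s g).
  have -> : creal (c * sqsum s g) = form s (conjc \o g) (fun x y => creal c * idm x y) g.
    rewrite formZ crealM creal_sum; congr (_ * _); apply: eq_big_seq => x xs.
    rewrite (bigD1_seq x) //= big1 ?addr0; last first.
      by move=> y yx; rewrite /idm eq_sym (negbTE yx) mulr0 mul0r.
    by rewrite /idm eqxx mulr1 mulrC mulcc.
  rewrite -formD; apply: eq_bigr => x _; rewrite (mappE _ _ us) // mulr_suml.
  by apply: eq_bigr => y _ /=; rewrite mulrC mulrA.
have cF : conjc (form s (conjc \o g) K g) = form s (conjc \o g) K g.
  rewrite form_conj form_tr; by apply: eq_form => // x _; exact: conjcK.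
have := B s (conjc \o g) g us; rewrite sqsum_conj.
case: (form _ _ _ _) cF => u v [] /eqP; rewrite eq_sym -addr_eq0 -mulr2n mulrn_eq0 /= => /eqP ->.
rewrite -[(u +i* 0)%C]/(creal u) cabs_creal -crealD => le.
rewrite /creal ler0c; have := ler_norm (- u); rewrite normrN; lra.
Qed.

Section OneState.
Variable phi : mat R p -> R[i].
Hypothesis st : is_state theta phi.

Lemma stateZ K (w : R[i]) : inA theta K -> phi (fun x y => w * K x y) = w * phi K.
Proof.
move=> AK; have [lin _ _] := st; transitivity (phi K + (w - 1) * phi K); last by ring.
rewrite -lin //; congr phi; apply/funext => x; apply/funext => y; ring.
Qed.

Lemma stateB K H : inA theta K -> inA theta H ->
  phi (fun x y => K x y - H x y) = phi K - phi H.
Proof.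
move=> AK AH; have [lin _ _] := st; rewrite -[- phi H]mulN1r -lin //; congr phi.
by apply/funext => x; apply/funext => y; rewrite mulN1r.
Qed.

Lemma state_shift K c : inA theta K -> selfadj_mat K -> Bnd K c -> 0 <= phi K + creal c.
Proof.
move=> AK sK B; have [lin pos id1] := st; rewrite -[creal c]mulr1 -id1 -lin //.
  by apply: pos; [apply: inA_lin => //; exact: inA_id | exact: pos_op_shift].
exact: inA_id.
Qed.

(** Positivity for both K + c and -K + c; the order on [R[i]] also forces the value to be real. *)
Lemma state_sa_le K c : inA theta K -> selfadj_mat K -> Bnd K c -> cabs (phi K) <= c.
Proof.
move=> AK sK B; have h1 := state_shift AK sK B.
have h2 : 0 <= - phi K + creal c.
  rewrite -mulN1r -stateZ //; apply: state_shift; first exact: inAZ.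
    by move=> x y; rewrite mulN1r sK mulN1r rmorphN.
  by apply: eq_Bnd (BndN B) => x y; rewrite mulN1r.
move: h1 h2; rewrite !lecE; case: (phi K) => u v /=.
rewrite addr0 => /andP [/eqP -> h1] /andP [_ h2].
rewrite -[(u +i* 0)%C]/(creal u) cabs_creal ler_norml; lra.
Qed.

(** The factor 2 comes from splitting into real and imaginary parts. *)
Lemma state_le K c : inA theta K -> Bnd K c -> cabs (phi K) <= 2 * c.
Proof.
move=> AK B; have [lin _ _] := st.
have -> : phi K = phi (re_mx K) + 'i%C * phi (im_mx K).
  rewrite -lin; [|exact: inA_re|exact: inA_im]; congr phi.
  by apply/funext => x; apply/funext => y; rewrite re_im_mx.
have h1 := state_sa_le (inA_re AK) (@re_mx_sa K) (Bnd_re B).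
have h2 := state_sa_le (inA_im AK) (@im_mx_sa K) (Bnd_im B).
apply: le_trans (cabsD _ _) _; rewrite cabsM cabs_i mul1r; lra.
Qed.

Lemma state_lam_sum f (s : seq (Gam p)) : uniq s -> (forall x, x \notin s -> f x = 0) ->
  phi (lam theta f) = \sum_(x <- s) f x * phi (lam theta (delta x)).
Proof.
have [lin _ _] := st; elim: s f => [|x s ih] f /=.
  move=> _ f0; rewrite big_nil -(mul0r (phi idm)) -(stateZ _ inA_id); congr phi.
  by apply/funext => u; apply/funext => v; rewrite mul0r /lam f0 // mulr0.
move=> /andP [xs us] f0; pose g z := if z == x then 0 else f z.
have fE : f = (fun z => g z + f x * delta x z).
  apply/funext => z; rewrite /g /delta; case: eqP => [->|_]; first by rewrite mulr1 add0r.
  by rewrite mulr0 addr0.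
have g0 z : z \notin s -> g z = 0.
  by rewrite /g; case: eqP => // /eqP zx zs; rewrite f0 // inE negb_or zx.
have -> : phi (lam theta f) = phi (lam theta g) + f x * phi (lam theta (delta x)).
  rewrite -lin; first last.
  - by apply: inA_lam; exact: CC_delta.
  - by apply: inA_lam; exact: finsupp_seq g0.
  by congr phi; rewrite {1}fE; apply/funext => u; apply/funext => v; rewrite lam_lin.
rewrite big_cons addrC (ih g) //; congr (_ + _); apply: eq_big_seq => z zs.
by rewrite /g; case: eqP => // zx; rewrite -zx zs in xs.
Qed.

End OneState.

(** Rescaling by [c + 1], which is positive even when [c = 0], puts [a] into the unit ball of the
    seminorm. *)
Lemma mkL_lam_le phi psi a c (M : R) : is_state theta phi -> is_state theta psi ->
  0 <= M -> (mkL theta phi psi <= M%:E)%E -> domL theta a -> Bnd (comm (lam theta a)) c ->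
  cabs (phi (lam theta a) - psi (lam theta a)) <= (c + 1) * M.
Proof.
move=> sphi spsi M0 le [Ca sa] B; have c0 := Bnd_ge0 B.
have c1 : 0 < c + 1 by lra.
have Aa := inA_lam Ca.
pose b x := creal (c + 1)^-1 * a x.
have lamb : lam theta b = (fun x y => creal (c + 1)^-1 * lam theta a x y).
  by apply/funext => x; apply/funext => y; rewrite lamZ.
have Db : domL theta b.
  split; first exact: CCZ.
  by move=> x y; rewrite lamb conjcM conjc_creal -sa.
have : (cabs (phi (lam theta b) - psi (lam theta b)) <= M).
  rewrite -lee_fin; apply: le_trans le; apply: ereal_sup_ubound; exists b => //; split=> //.
  apply/LD_leP; have := Bnd_comm_Z (creal (c + 1)^-1) B.
  apply: Bnd_le; rewrite cabs_creal ger0_norm ?invr_ge0 ?(ltW c1) //.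
  by rewrite mulrC ler_pdivrMr // mul1r; lra.
rewrite lamb !stateZ // -mulrBr cabsM cabs_creal ger0_norm ?invr_ge0 ?(ltW c1) //.
by rewrite mulrC ler_pdivrMr // mulrC.
Qed.

(** Approximation by a finitely supported element, whose real and imaginary parts have finite
    seminorm. The constant [C] does not depend on the states, so this gives both separation of
    states and weak* continuity. *)
Lemma mkL_control K e : inA theta K -> 0 < e -> exists2 C, 0 <= C &
  forall phi psi M, is_state theta phi -> is_state theta psi -> 0 <= M ->
    (mkL theta phi psi <= M%:E)%E -> cabs (psi K - phi K) <= e + C * M.
Proof.
(* Each of the two states contributes an approximation error of at most 2 times [e / 4]. *)
move=> AK e0; have e40 : 0 < e / 4 by lra.
have [f [Cf B]] := (inAP K).1 AK _ e40.
have Af := inA_lam Cf.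
have [c1 _ B1] := LD_fin theta p_pr (domL_re Cf).1.
have [c2 _ B2] := LD_fin theta p_pr (domL_im Cf).1.
have c10 := Bnd_ge0 B1; have c20 := Bnd_ge0 B2.
exists ((c1 + 1) + (c2 + 1)); first by lra.
move=> phi psi M sphi spsi M0 le.
have AD : inA theta (fun x y => K x y - lam theta f x y).
  have := inA_lin (-1) AK Af; congr (inA _).
  by apply/funext => x; apply/funext => y; rewrite mulN1r.
have hphi := state_le sphi AD B; have hpsi := state_le spsi AD B.
rewrite (stateB sphi) // in hphi; rewrite (stateB spsi) // in hpsi.
have split_state chi : is_state theta chi ->
    chi (lam theta f) = chi (lam theta (re_fun f)) + 'i%C * chi (lam theta (im_fun f)).
  move=> [lin _ _]; rewrite lam_re lam_im -lin; [|exact: inA_re|exact: inA_im].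
  by congr chi; apply/funext => x; apply/funext => y; rewrite re_im_mx.
have h1 := mkL_lam_le sphi spsi M0 le (domL_re Cf) B1.
have h2 := mkL_lam_le sphi spsi M0 le (domL_im Cf) B2.
have hf : cabs (phi (lam theta f) - psi (lam theta f)) <= (c1 + 1 + (c2 + 1)) * M.
  rewrite !split_state // mulrDl opprD addrACA -mulrBr.
  apply: le_trans (cabsD _ _) _; rewrite cabsM cabs_i mul1r; exact: lerD.
have -> : psi K - phi K = (psi K - psi (lam theta f)) - (phi K - phi (lam theta f))
   - (phi (lam theta f) - psi (lam theta f)) by ring.
apply: le_trans (cabsB _ _) _; apply: lerD => //.
apply: le_trans (cabsB _ _) _; lra.
Qed.

Lemma cutoff_bounds n z : 0 <= cutoff R n z <= 1.
Proof.
rewrite /cutoff /avg; apply/andP; split; first exact: divr_ge0.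
by rewrite ler_pdivrMr ?ltr0n ?size_box_gt0 // mul1r ler_nat; exact: count_size.
Qed.

(** An element of the unit ball splits into a tail, costing 2 [tail_const] per state, and a part on
    [box (n + 4)], whose coefficients the column at 0 of the commutator bounds by 1/LSig. *)
Lemma mkL_le phi psi n : is_state theta phi -> is_state theta psi ->
  (mkL theta phi psi <= (4 * tail_const R p n + \sum_(x <- box p (n + 4))
     (LSig R x)^-1 * cabs (psi (lam theta (delta x)) - phi (lam theta (delta x))))%:E)%E.
Proof.
move=> sphi spsi; apply: ge_ereal_sup => _ [a [[Ca sa] /LD_leP B] <-]; rewrite lee_fin.
pose t z := creal (1 - cutoff R n z) * a z; pose h z := creal (cutoff R n z) * a z.
have h0 z : z \notin box p (n + 4) -> h z = 0.
  by move=> zn; rewrite /h cutoff_eq0 // creal0 mul0r.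
have Ct : CC t.
  by have [s us a0] := finsuppP Ca; apply: (@finsupp_seq _ _ s) => z /a0; rewrite /t => ->; rewrite mulr0.
have Bt := Bnd_tail p_pr thetaO n Ca B; rewrite mulr1 -/t in Bt.
have st_split chi : is_state theta chi -> chi (lam theta a) = chi (lam theta t) +
    \sum_(x <- box p (n + 4)) h x * chi (lam theta (delta x)).
  move=> schi; rewrite -(state_lam_sum schi (box_uniq p_pr _) h0).
  have [lin _ _] := schi; rewrite -[chi (lam theta h)]mul1r -lin.
  - congr chi; apply/funext => x; apply/funext => y.
    rewrite -lam_lin; congr (lam theta _ x y); apply/funext => z.
    by rewrite /t /h mul1r crealB creal1; ring.
  - exact: inA_lam.
  - by apply: inA_lam; exact: finsupp_seq h0.
rewrite !st_split // opprD addrACA; apply: le_trans (cabsD _ _) _; apply: lerD.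
  apply: le_trans (cabsB _ _) _.
  have := state_le sphi (inA_lam Ct) Bt; have := state_le spsi (inA_lam Ct) Bt; lra.
rewrite -sumrB; apply: le_trans (cabs_sum _ _) _; apply: ler_sum => x _.
rewrite -mulrBr cabsM -(cabsN (phi _ - _)) opprB.
(* At 0 the length vanishes and its inverse is 0 by convention; the term drops out because both
   states take the value 1 on the identity. *)
have [->|x0] := eqVneq x 0.
  have -> : lam theta (delta 0) = idm by exact: lam_delta0.
  by have [_ _ ->] := sphi; have [_ _ ->] := spsi; rewrite subrr cabs0 !mulr0.
rewrite ler_wpM2r ?cabs_ge0 // /h cabsM cabs_creal.
have /andP [ph0 ph1] := cutoff_bounds n x; rewrite ger0_norm //.
have := Bnd_entry x 0 B; rewrite /comm (lam0 p_pr thetaO) (LSig0 R p) subr0 cabsM cabs_creal.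
rewrite gtr0_norm ?LSig_gt0 // mulrC -ler_pdivlMr ?LSig_gt0 // div1r.
by apply: le_trans; rewrite ler_piMl ?cabs_ge0.
Qed.

Lemma tail_const_lim e : 0 < e -> exists n, tail_const R p n < e.
Proof.
move=> e0; set B : R := 2 * (p ^ 40)%:R.
have B0 : 0 <= B by rewrite mulr_ge0.
exists (Num.Def.archi_bound (B / e)); set k := Num.Def.archi_bound _.
have pk : 0 < p%:R ^+ k :> R by rewrite exprn_gt0 // ltr0n prime_gt0.
rewrite /tail_const -/B ltr_pdivrMr // mulrC -ltr_pdivrMr //.
apply: lt_le_trans (archi_boundP (divr_ge0 B0 (ltW e0))) _.
by rewrite -natrX ler_nat ltnW // ltn_expl // prime_gt1.
Qed.

Lemma mkL_neighborhood phi (s : seq (mat R p)) e : is_state theta phi ->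
  (forall K, K \in s -> inA theta K) -> 0 < e ->
  exists2 d : R, 0 < d & forall psi, is_state theta psi ->
    (mkL theta phi psi < d%:E)%E -> forall K, K \in s -> cabs (psi K - phi K) < e.
Proof.
move=> sphi sA e0; elim: s sA => [|K s ih] sA; first by exists 1.
have [|d1 d10 h1] := ih; first by move=> H Hs; apply: sA; rewrite inE Hs orbT.
have e20 : 0 < e / 2 by lra.
have [C C0 hC] := mkL_control (sA K (mem_head _ _)) e20.
have C1 : 0 < 2 * (C + 1) by lra.
have d20 : 0 < e / (2 * (C + 1)) by rewrite divr_gt0.
exists (Num.min d1 (e / (2 * (C + 1)))); first by rewrite lt_min d10.
move=> psi spsi lt H; rewrite inE => /orP [/eqP ->|Hs]; last first.
  by apply: h1 Hs => //; apply: lt_le_trans lt _; rewrite lee_fin ge_min lexx.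
have le : (mkL theta phi psi <= (e / (2 * (C + 1)))%:E)%E.
  by apply: ltW; apply: lt_le_trans lt _; rewrite lee_fin ge_min lexx orbT.
apply: le_lt_trans (hC phi psi _ sphi spsi (ltW d20) le) _.
have : C * (e / (2 * (C + 1))) < e / 2.
  by rewrite mulrA ltr_pdivrMr //; nra.
lra.
Qed.

Lemma weak_star_neighborhood phi (d : R) : is_state theta phi -> 0 < d ->
  exists s : seq (mat R p), exists2 e : R,
    (forall K, K \in s -> inA theta K) /\ 0 < e &
    forall psi, is_state theta psi ->
      (forall K, K \in s -> cabs (psi K - phi K) < e) -> (mkL theta phi psi < d%:E)%E.
Proof.
(* The tail then costs less than [d / 2] and the finite sum at most [d / 4]. *)
move=> sphi d0; have d80 : 0 < d / 8 by lra.
have [n tn] := tail_const_lim d80.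
set W := \sum_(x <- box p (n + 4)) (LSig R x)^-1.
have W0 : 0 <= W by apply: sumr_ge0 => x _; rewrite invr_ge0 LSig_ge0.
have W1 : 0 < 4 * (W + 1) by lra.
exists [seq lam theta (delta x) | x <- box p (n + 4)], (d / (4 * (W + 1))).
  split; last by rewrite divr_gt0.
  by move=> K /mapP [x _ ->]; apply: inA_lam; exact: CC_delta.
move=> psi spsi close; apply: le_lt_trans (mkL_le n sphi spsi) _; rewrite lte_fin.
have : \sum_(x <- box p (n + 4)) (LSig R x)^-1 *
    cabs (psi (lam theta (delta x)) - phi (lam theta (delta x))) <= W * (d / (4 * (W + 1))).
  rewrite mulr_suml big_seq [leRHS]big_seq; apply: ler_sum => x xs.
  apply: ler_wpM2l; first by rewrite invr_ge0 LSig_ge0.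
  by apply: ltW; apply: close; apply/mapP; exists x.
have : W * (d / (4 * (W + 1))) <= d / 4.
  by rewrite mulrA ler_pdivrMr //; nra.
lra.
Qed.

End States.

(** * Verification of the axioms of a Leibniz quantum compact metric space *)

Theorem theorem3p14 (R : realType) (p : nat) (theta : nat -> R) :
  prime p -> Omega p theta -> LeibnizQCMS p theta.
Proof.
move=> p_pr thetaO; split.
- split.
  + by move=> a [Ca _]; exact: inA_lam.
  + by move=> a b t Da Db; exact: domL_lin.
  + by move=> K AK sK e e0; exact: domL_dense.
  + by move=> a [/(LD_fin theta p_pr) [c -> _] _]; rewrite ltry.
  + move=> a b t [Ca _] [Cb _]; split; [exact: LDD|exact: LDZ].
- by move=> a; exact: LD_eq0P.
- split.
  (* Already the truncation at level 0 gives a real bound on the distance. *)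
  + by move=> phi psi sphi spsi; apply: le_lt_trans (mkL_le p_pr thetaO 0 sphi spsi) (ltry _).
  + move=> phi psi sphi spsi mk0 K AK; apply/eqP; rewrite eq_sym -subr_eq0 -cabs_eq0.
    rewrite eq_le cabs_ge0 andbT; apply/ler_addgt0Pr => e e0; rewrite add0r.
    have [C _ hC] := mkL_control p_pr thetaO AK e0.
    (* At distance 0 the term with [C] disappears and only the arbitrary [e] remains. *)
    have := hC phi psi 0 sphi spsi (lexx 0); rewrite mulr0 addr0; apply.
    by rewrite mk0.
  + by move=> phi sphi s e sA e0; exact: mkL_neighborhood.
  + by move=> phi sphi d d0; exact: weak_star_neighborhood.
- move=> a b Da Db; have [h1 h2] := LD_leibniz p_pr thetaO Da Db; split=> //.
    exact: domL_jordan.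
  exact: domL_lie.
- by move=> a Da e e0; exact: LD_lsc.
Qed.
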